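(* Let $K$ denote the convex hull of $K_0$ and assume that the orthogonal cone $K^\perp=\{\eta\in\mathbb{M}^{n\times n}_{\rm sym}:(\xi,\eta)\le0\ \text{for all }\xi\in K\}$ has non-empty interior. Then there exists a constant $c>0$ such that the homogenized energy density $f_{\rm hom}$ satisfies $$f_{\rm hom}(\xi)\le c|\xi|$$ for all $\xi\in H_{\rm hom}$, where $H_{\rm hom}=\{\xi\in\mathbb{M}^{n\times n}_{\rm sym}:g_{\rm hom}(\xi)=0\}$.
   Context: $\mathbb{M}^{n\times n}_{\rm sym}$ is the space of symmetric real $n\times n$ matrices with Euclidean scalar product $(\cdot,\cdot)$ and norm $|\cdot|$; $a\odot b=\frac12(a\otimes b+b\otimes a)$. A positive definite symmetric linear operator $A:\mathbb{M}^{n\times n}_{\rm sym}\to\mathbb{M}^{n\times n}_{\rm sym}$ is fixed, and $\|\xi\|=(A\xi,\xi)^{1/2}$. $Y=(0,1)^n$; $B\subset\mathbb{R}^n$ is a closed rectifiable $(n-1)$-dimensional set which is $Y$-periodic, i.e. $B+k=B$ for all $k\in\mathbb{Z}^n$. $K_0$ is a closed cone in $\mathbb{M}^{n\times n}_{\rm sym}$ consisting of matrices of the form $a\odot b$, such that $a\odot(b+c)\in K_0$ whenever $a\odot b,a\odot c\in K_0$. For a matrix $\xi$, $u_\xi(x)=\xi x$. $BD$ is the space of $L^1$ vector fields $u$ whose symmetrized distributional gradient $\mathrm{E}u$ is a (finite) measure, with Lebesgue decomposition $\mathrm{E}u=\mathcal{E}u\,\mathcal{L}^n+\mathrm{E}^su$;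 $J_u$ is the jump set, $u^\pm$ the traces on its two sides, $\nu_u$ its unit normal. $SBD$ is the subset of $u\in BD$ with $\mathrm{E}^su=(u^+-u^-)\odot\nu_u\,\mathcal{H}^{n-1}$ restricted to $J_u$. For $\xi\in\mathbb{M}^{n\times n}_{\rm sym}$ let $\mathcal{T}_\xi$ be the set of $u\in SBD_{\rm loc}(\mathbb{R}^n)$ with $J_u\subseteq B$, $(u^+-u^-)\odot\nu_u\in K_0$ $\mathcal{H}^{n-1}$-a.e., and $u-u_\xi$ $Y$-periodic (i.e. $\mathbb{Z}^n$-periodic). Then $$f_{\rm hom}(\xi)=\inf_{u\in\mathcal{T}_\xi}\Big\{\frac12\int_Y\|\mathcal{E}u\|^2dx+\int_{J_u\cap[0,1)^n}|u^+-u^-|\,d\mathcal{H}^{n-1}\Big\},\qquad g_{\rm hom}(\xi)=\inf_{u\in\mathcal{T}_\xi}\frac12\int_Y\|\mathcal{E}u\|^2dx.$$ *)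

(* Defs.v *)
From HB Require Import structures.
From mathcomp Require Import all_boot all_order all_algebra.
From mathcomp Require Import all_classical all_reals all_analysis.
From mathcomp Require Import lra.

Set Implicit Arguments.
Unset Strict Implicit.
Unset Printing Implicit Defensive.

Import Order.TTheory GRing.Theory Num.Theory.
Import numFieldNormedType.Exports.

Local Open Scope classical_set_scope.
Local Open Scope ring_scope.

Section euclidean.
Context {R : realType}.

(* On 'rV and 'M the library norm `| _ | is the sup norm; it is used below only
   for topological notions. *)
Definition mxdot m n (x y : 'M[R]_(m, n)) : R :=
  \sum_i \sum_j x i j * y i j.

Definition mxnorm m n (x : 'M[R]_(m, n)) : R := Num.sqrt (mxdot x x).

Definition Msym n : set 'M[R]_n := [set xi | xi^T = xi].

Definition odot n (a b : 'rV[R]_n) : 'M[R]_n :=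
  2^-1 *: (a^T *m b + b^T *m a).

(* points are rows, so that xi x reads x *m xi^T *)
Definition affine n (xi : 'M[R]_n) (x : 'rV[R]_n) : 'rV[R]_n := x *m xi^T.

Definition open_cell n : set 'rV[R]_n := [set x | forall i, 0 < x 0 i < 1].
Definition half_open_cell n : set 'rV[R]_n :=
  [set x | forall i, 0 <= x 0 i < 1].

Definition intvec n (k : 'rV[int]_n) : 'rV[R]_n := map_mx intr k.

End euclidean.

Definition open_sets (R : realType) n : set (set 'rV[R]_n) := [set A | open A].

Notation borel R n := (g_sigma_algebraType (@open_sets R n)).

Section lebesgue.
Context {R : realType}.

Lemma measurable_coord n (j : 'I_n) :
  measurable_fun [set: borel R n] (fun x : 'rV[R]_n => x 0 j).
Proof.
apply: (measurability _ (measurable_realfun.RGenOpens.measurableE R)).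
move=> /= _ [_ [a [b ->]] <-]; rewrite setTI; apply: sub_sigma_algebra.
apply: (@open_comp _ _ (fun x : 'rV[R]_n => x 0 j)).
  by move=> x _; exact: coord_continuous.
exact: interval_open.
Qed.

Lemma measurable_fun_rV d (T : measurableType d) n (f : T -> 'rV[R]_n) :
  (forall j, measurable_fun [set: T] (fun t => f t 0 j)) ->
  measurable_fun [set: T] (f : T -> borel R n).
Proof.
move=> mf; apply: (@measurability _ _ _ (borel R n) _ _ (@open_sets R n)) => // _ [U oU <-]; rewrite setTI.
have mball (c : 'rV[R]_n) (e : R) : 0 < e -> measurable (f @^-1` ball c e).
  move=> e0.
  rewrite (_ : _ @^-1` _ =
      \bigcap_(j in [set: 'I_n]) (fun t => f t 0 j) @^-1` ball (c 0 j) e).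
    apply: fin_bigcap_measurable; first exact: finite_finset.
    move=> j _; rewrite -[X in measurable X]setTI; apply: mf => //.
    exact: measurable_realfun.measurable_ball.
  apply/seteqP; split=> [t [_ h] j _|t h]; first exact: h.
  by split=> // i j; rewrite (ord1 i); exact: h.
pose F (p : 'rV[rat]_n * nat) : set T :=
  if pselect (ball (map_mx ratr p.1 : 'rV[R]_n) p.2.+1%:R^-1 `<=` U)
  then f @^-1` ball (map_mx ratr p.1 : 'rV[R]_n) p.2.+1%:R^-1 else set0.
rewrite (_ : _ @^-1` _ = \bigcup_p F p).
  apply: countable_bigcupT_measurable; first exact: countableP.
  by move=> p; rewrite /F; case: pselect => /= _; [exact: mball|exact: measurable0].
apply/seteqP; split=> [t Uft|t [p _]]; last first.
  by rewrite /F; case: pselect => /= [pU|//]; exact: pU.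
have [e /= e0 eU] : nbhs_ball (f t) U.
  by apply/nbhs_ballP; exact: open_nbhs_nbhs (conj oU Uft).
have [k] : exists k : nat, k.+1%:R^-1 < e / 2.
  have [k _ hk] := near_infty_natSinv_lt (PosNum (divr_gt0 e0 (ltr0Sn R 1))).
  by exists k; apply: hk => /=.
set r := k.+1%:R^-1 => rlt.
have r0 : 0 < r by rewrite invr_gt0.
have /choice[q hq] (j : 'I_n) :
    exists q : rat, ball (f t 0 j) r (ratr q : R).
  have lt_fr : f t 0 j < f t 0 j + r by rewrite ltrDl.
  have [q] := rat_in_itvoo lt_fr; rewrite in_itv /= => /andP[q1 q2]; exists q.
  by rewrite /ball /= ltr_distlC; apply/andP; split=> //; lra.
exists (\row_j q j, k) => //; rewrite /F /=.
have cf : ball (map_mx ratr (\row_j q j) : 'rV[R]_n) r (f t).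
  by split=> // i j; rewrite (ord1 i) !mxE; apply: ball_sym; exact: hq.
case: pselect => /= [//|]; case=> y ycr; apply: eU.
by rewrite [e]splitr; apply: (ball_triangle (ball_sym (le_ball (ltW rlt) cf)));
  exact: (le_ball (ltW rlt) ycr).
Qed.

Definition row_cons n (p : measurableTypeR R * borel R n) : borel R n.+1 :=
  row_mx (p.1%:M : 'M[R]_1) (p.2 : 'rV[R]_n).

Definition row_uncons n (x : borel R n.+1) : measurableTypeR R * borel R n :=
  ((x : 'rV[R]_n.+1) 0 0, rsubmx (x : 'rV[R]_(1 + n))).

Lemma row_consK n : cancel (@row_cons n) (@row_uncons n).
Proof.
case=> a y; rewrite /row_uncons /row_cons /= row_mxKr; congr (_, _).
have := row_mxEl (a%:M : 'M[R]_1) (y : 'rV[R]_n) 0 0.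
rewrite [in RHS]mxE mulr1n; apply: etrans.
by congr (row_mx _ _ _ _); exact: val_inj.
Qed.

Lemma measurable_row_cons n : measurable_fun setT (@row_cons n).
Proof.
apply: measurable_fun_rV => j.
case: (split_ordP (j : 'I_(1 + n))) => k ->; rewrite /row_cons.
  apply: (eq_measurable_fun fst) => //=.
  by move=> p _; rewrite (row_mxEl (p.1%:M : 'M[R]_1)) mxE (ord1 k) mulr1n.
apply: (@eq_measurable_fun _ _ (measurableTypeR R * borel R n)%type _ _
  (fun p => (p.2 : 'rV[R]_n) 0 k)) => //=.
  by move=> p _; rewrite (row_mxEr (p.1%:M : 'M[R]_1)).
exact: (measurableT_comp (measurable_coord k) measurable_snd).
Qed.

Lemma measurable_row_uncons n : measurable_fun setT (@row_uncons n).
Proof.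
apply/measurable_fun_pairP; split; first exact: measurable_coord.
apply: measurable_fun_rV => j; under eq_fun do rewrite /= mxE.
exact: measurable_coord.
Qed.

Section step.
Variables (n : nat) (m : {sigma_finite_measure set (borel R n) -> \bar R}).

Definition leb_succ : set (borel R n.+1) -> \bar R :=
  pushforward (@lebesgue_measure R \x m)%E (@row_cons n).

Let leb_succ0 : leb_succ set0 = 0%E.
Proof. by rewrite /leb_succ /pushforward preimage_set0 measure0. Qed.

Let leb_succ_ge0 A : (0 <= leb_succ A)%E.
Proof. by rewrite /leb_succ /pushforward; exact: measure_ge0. Qed.

Let mpre A : measurable A -> measurable (@row_cons n @^-1` A).
Proof.
by move=> mA; rewrite -[X in measurable X]setTI; exact: measurable_row_cons.
Qed.

Let leb_succ_sigma_additive : semi_sigma_additive leb_succ.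
Proof.
move=> F mF tF mUF; rewrite /leb_succ /pushforward preimage_bigcup.
apply: measure_semi_sigma_additive => [k||]; first exact: mpre.
- apply/trivIsetP => /= i j _ _ ij; rewrite -preimage_setI.
  by move/trivIsetP : tF => /(_ _ _ _ _ ij) ->//; rewrite preimage_set0.
- by rewrite -preimage_bigcup; exact: mpre.
Qed.

HB.instance Definition _ := isMeasure.Build _ _ _ leb_succ
  leb_succ0 leb_succ_ge0 leb_succ_sigma_additive.

Let leb_succ_sigma_finite : sigma_finite setT leb_succ.
Proof.
have /sigma_finiteP[F [TF ndF Foo]] :=
  sigma_finiteT (lebesgue_stieltjes_measure (@idfun R)).
have /sigma_finiteP[G [TG ndG Goo]] := sigma_finiteT m.
exists (fun k => @row_uncons n @^-1` (F k `*` G k)).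
  rewrite -preimage_bigcup (_ : \bigcup_k _ = setT) ?preimage_setT//.
  rewrite -setXTT TF TG predeqE => -[x y]; split.
    by move=> [k _ [? ?]]; split; exists k.
  move=> [/= [k _ Fkx] [l _ Gly]]; exists (maxn k l) => //; split.
  - by move: x Fkx; exact/subsetPset/ndF/leq_maxl.
  - by move: y Gly; exact/subsetPset/ndG/leq_maxr.
move=> k; have [mF Fk] := Foo k; have [mG Gk] := Goo k; split.
  rewrite -[X in measurable X]setTI; apply: measurable_row_uncons => //.
  exact: measurableX.
rewrite /leb_succ /pushforward -comp_preimage.
rewrite (_ : _ \o _ = id); last by apply/funext => p; exact: row_consK.
by rewrite product_measure1E// lte_mul_pinfty// ge0_fin_numE.
Qed.

HB.instance Definition _ := Measure_isSigmaFinite.Build _ _ _ leb_succ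
  leb_succ_sigma_finite.

End step.

Fixpoint leb n : {sigma_finite_measure set (borel R n) -> \bar R} :=
  match n with
  | 0 => @dirac _ (borel R 0) (0 : 'rV[R]_0) R
  | n'.+1 => leb_succ (leb n')
  end.

End lebesgue.

Section hausdorff.
Context {R : realType}.
Local Open Scope ereal_scope.

Definition ball_volume s : R :=
  fine (leb s [set x : 'rV[R]_s | (mxnorm x <= 1)%R]).

Definition diam n (C : set 'rV[R]_n) : R :=
  sup [set mxnorm (x - y) | x in C & y in C].

(* The empty set has weight 0 also for s = 0, where 0 ^+ 0 = 1. *)
Definition hausdorff_weight n s (delta : R) (C : set (borel R n)) : \bar R :=
  if `[< C = set0 >] then 0
  else if `[< forall x y, C x -> C y -> (mxnorm (x - y : 'rV[R]_n) <= delta)%R >]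
  then (ball_volume s * (diam C / 2) ^+ s)%:E
  else +oo.

(* mu_ext takes the infimum over countable covers by Borel sets; since a set and
   its closure have the same diameter this is the same as over all covers. *)
Definition hausdorff n s (A : set 'rV[R]_n) : \bar R :=
  ereal_sup [set mu_ext (@hausdorff_weight n s delta) A
             | delta in [set delta : R | (0 < delta)%R]].

Lemma ball_volume_ge0 s : (0 <= ball_volume s)%R.
Proof. by rewrite fine_ge0. Qed.

Lemma diam_ge0 n (C : set 'rV[R]_n) : (0 <= diam C)%R.
Proof.
rewrite /diam; set D := (X in sup X).
have [hs|/sup_out ->//] := pselect (has_sup D).
have [[d [x Cx [y Cy _]]] _] := hs.
have Dxy : D (mxnorm (x - y)) by exists x => //; exists y.
exact: le_trans (sqrtr_ge0 _) (ub_le_sup hs.2 Dxy).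
Qed.

Lemma hausdorff_weight0 n s delta : @hausdorff_weight n s delta set0 = 0.
Proof. by rewrite /hausdorff_weight asboolT. Qed.

Lemma hausdorff_weight_ge0 n s delta C : 0 <= @hausdorff_weight n s delta C.
Proof.
rewrite /hausdorff_weight; case: ifP => // _; case: ifP => // _.
by rewrite lee_fin mulr_ge0 ?ball_volume_ge0// exprn_ge0// divr_ge0// diam_ge0.
Qed.

Section outer.
Variables n s : nat.

Let hausdorff0 : @hausdorff n s set0 = 0.
Proof.
rewrite /hausdorff; set S := (X in ereal_sup X).
suff -> : S = [set 0] by rewrite ereal_sup1.
apply/seteqP; split=> [_ [d _ <-]|_ ->] /=.
  exact: (mu_ext0 (hausdorff_weight0 n s _) (@hausdorff_weight_ge0 n s _)).
exists 1%R => //=.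
exact: (mu_ext0 (hausdorff_weight0 n s _) (@hausdorff_weight_ge0 n s _)).
Qed.

Let hausdorff_ge0 (A : set 'rV[R]_n) : 0 <= hausdorff s A.
Proof.
apply: (le_trans (mu_ext_ge0 (@hausdorff_weight_ge0 n s 1) A)).
by apply: ereal_sup_ubound; exists 1%R => //=.
Qed.

Let le_hausdorff : {homo @hausdorff n s : A B / A `<=` B >-> A <= B}.
Proof.
move=> A B AB; apply: ge_ereal_sup => _ [d d0 <-].
apply: (le_trans (le_mu_ext (@hausdorff_weight n s d) AB)).
by apply: ereal_sup_ubound; exists d.
Qed.

Let hausdorff_sigma_subadditive : sigma_subadditive (@hausdorff n s).
Proof.
move=> F; apply: ge_ereal_sup => _ [d d0 <-].
have := mu_ext_sigma_subadditive (@hausdorff_weight_ge0 n s d) F.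
move/le_trans; apply.
apply: lee_nneseries => [i _ _|i _].
  exact: (mu_ext_ge0 (@hausdorff_weight_ge0 n s d)).
by apply: ereal_sup_ubound; exists d.
Qed.

HB.instance Definition _ := isOuterMeasure.Build R 'rV[R]_n (@hausdorff n s)
  hausdorff0 hausdorff_ge0 le_hausdorff hausdorff_sigma_subadditive.

End outer.

Definition Houter n s : {outer_measure set 'rV[R]_n -> \bar R} :=
  @hausdorff n s.

(* H^s as a measure on its Caratheodory-measurable sets *)
Definition Hmeas n s : {measure set (caratheodory_type (Houter n s)) -> \bar R} :=
  (Houter n s : set (caratheodory_type (Houter n s)) -> \bar R).

End hausdorff.

Section jump.
Context {R : realType} (n : nat).
Implicit Types (u : 'rV[R]_n -> 'rV[R]_n) (x a b nu : 'rV[R]_n).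

Definition half_ball x nu (r : R) : set 'rV[R]_n :=
  [set y | mxnorm (y - x) < r /\ 0 < mxdot (y - x) nu].

Definition one_sided_limit u x nu a :=
  ((r ^- n)%:E * \int[leb n]_(y in half_ball x nu r) (mxnorm (u y - a))%:E)%E
    @[r --> 0^'+] --> 0%E.

Definition is_jump u x (p : 'rV[R]_n * 'rV[R]_n * 'rV[R]_n) :=
  [/\ p.1.1 <> p.1.2, mxnorm p.2 = 1,
      one_sided_limit u x p.2 p.1.1 & one_sided_limit u x (- p.2) p.1.2].

Definition jump_set u : set 'rV[R]_n := [set x | exists p, is_jump u x p].

(* The triple is unique up to replacing (a, b, nu) by (b, a, - nu), so the choice
   made here does not affect |u^+ - u^-| nor (u^+ - u^-) (.) nu_u. *)
Definition jump_data u x : 'rV[R]_n * 'rV[R]_n * 'rV[R]_n :=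
  xget (0, 0, 0) [set p | is_jump u x p].

Definition jump_height u x : 'rV[R]_n := (jump_data u x).1.1 - (jump_data u x).1.2.

Definition jump_tensor u x : 'M[R]_n := odot (jump_height u x) (jump_data u x).2.

End jump.

Section test_functions.
Context {R : realType} (n : nat).

Definition partial (j : 'I_n) (phi : 'rV[R]_n -> R) : 'rV[R]_n -> R :=
  fun x => 'D_(delta_mx 0 j) phi x.

Fixpoint Ck (k : nat) (phi : 'rV[R]_n -> R) : Prop :=
  continuous phi /\
  match k with
  | 0 => True
  | k'.+1 => forall j : 'I_n,
      (forall x, derivable phi x (delta_mx 0 j)) /\ Ck k' (partial j phi)
  end.

Definition test_function (Om : set 'rV[R]_n) (phi : 'rV[R]_n -> R) :=
  [/\ forall k, Ck k phi, compact (closure [set x | phi x != 0]) &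
      closure [set x | phi x != 0] `<=` Om].

End test_functions.

Definition charge_integral d (T : measurableType d) (R : realType)
    (nu : {charge set T -> \bar R}) (D : set T) (f : T -> R) : R :=
  let P := cid (Hahn_decomposition nu) in
  let N := cid (svalP P) in
  \int[jordan_pos (svalP N)]_(x in D) f x -
  \int[jordan_neg (svalP N)]_(x in D) f x.

Section SBD.
Context {R : realType} (n : nat).
Local Notation matrix_charge :=
  ('I_n -> 'I_n -> {charge set (borel R n) -> \bar R}).
Implicit Types (Om : set 'rV[R]_n) (u : 'rV[R]_n -> 'rV[R]_n)
  (e : 'rV[R]_n -> 'M[R]_n) (mu mus : matrix_charge).

Definition L1 Om u :=
  forall i, (leb n).-integrable Om (fun x => (u x 0 i)%:E).

(* Eu = mu in the sense of distributions on Om *)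
Definition is_sym_gradient Om u mu :=
  forall phi, test_function Om phi -> forall i j,
    2^-1 * \int[leb n]_(x in Om)
      (u x 0 i * partial j phi x + u x 0 j * partial i phi x) =
    - charge_integral (mu i j) Om phi.

Definition BD Om u := L1 Om u /\ exists mu, is_sym_gradient Om u mu.

(* mu = e L^n + mus on Om, with mus singular *)
Definition lebesgue_decomposition Om mu e mus :=
  forall i j,
  [/\ (leb n).-integrable Om (fun x => (e x i j)%:E),
      forall A : set (borel R n), measurable A -> A `<=` Om ->
        mu i j A = (\int[leb n]_(x in A) (e x i j)%:E + mus i j A)%E &
      exists N : set (borel R n), [/\ measurable N, leb n N = 0%E &
        forall A : set (borel R n), measurable A -> A `<=` Om `\` N ->
          mus i j A = 0%E]].

(* mus = (u^+ - u^-) (.) nu_u H^(n-1) restricted to J_u, on Om *)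
Definition is_jump_part Om u mus :=
  let d i j x := (\1_(jump_set u) x * jump_tensor u x i j)%:E in
  forall i j,
    (Hmeas n n.-1).-integrable Om (d i j) /\
    forall A : set (borel R n), measurable A -> A `<=` Om ->
      mus i j A = (\int[Hmeas n n.-1]_(x in A) d i j x)%E.

(* u is in SBD(Om) and e is a representative of the density of the absolutely
   continuous part of Eu *)
Definition SBD Om u e :=
  [/\ BD Om u, forall x, Msym (e x) &
      exists mu mus, [/\ is_sym_gradient Om u mu,
        lebesgue_decomposition Om mu e mus & is_jump_part Om u mus]].

Definition SBD_loc u e :=
  forall Om, open Om -> bounded_set Om -> SBD Om u e.

End SBD.

Section homogenization.
Context {R : realType} (n : nat).
Implicit Types (A : 'M[R]_n -> 'M[R]_n) (B : set 'rV[R]_n) (K : set 'M[R]_n)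
  (xi eta : 'M[R]_n) (u : 'rV[R]_n -> 'rV[R]_n) (e : 'rV[R]_n -> 'M[R]_n).

(* an operator on the symmetric matrices, given by its action inside 'M_n *)
Definition pos_def_sym_operator A :=
  [/\ forall xi, Msym xi -> Msym (A xi),
      forall xi eta, Msym xi -> Msym eta -> mxdot (A xi) eta = mxdot xi (A eta) &
      forall xi, Msym xi -> xi != 0 -> 0 < mxdot (A xi) xi].

Definition opnorm A xi : R := Num.sqrt (mxdot (A xi) xi).

Definition rectifiable B :=
  exists f : nat -> 'rV[R]_n.-1 -> 'rV[R]_n,
    (forall k, exists L : R, forall x y,
      mxnorm (f k x - f k y) <= L * mxnorm (x - y)) /\
    hausdorff n.-1 (B `\` \bigcup_k range (f k)) = 0%E.

Definition periodic_set B :=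
  forall k : 'rV[int]_n, [set x + intvec k | x in B] = B.

Definition is_cone K := K 0 /\ forall t xi, 0 < t -> K xi -> K (t *: xi).

Definition convex_hull K : set 'M[R]_n :=
  smallest (@convex_set R 'M[R]_n) K.

Definition orthogonal_cone K : set 'M[R]_n :=
  [set eta | Msym eta /\ forall xi, K xi -> mxdot xi eta <= 0].

(* interior relative to the space of symmetric matrices *)
Definition Msym_interior K : set 'M[R]_n :=
  @Msym R n `&` interior (K : set (subspace (@Msym R n))).

(* u - u_xi is an element of L^1_loc, so its periodicity is up to null sets *)
Definition admissible B K0 xi u e :=
  [/\ SBD_loc u e,
      jump_set u `<=` B,
      {ae Hmeas n n.-1, forall x, jump_set u x -> K0 (jump_tensor u x)} &
      forall k : 'rV[int]_n, {ae leb n, forall x : 'rV[R]_n,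
        u (x + intvec k) - affine xi (x + intvec k) = u x - affine xi x}].

Local Open Scope ereal_scope.

Definition bulk_energy A e : \bar R :=
  (2^-1)%:E * \int[leb n]_(x in @open_cell R n) (opnorm A (e x) ^+ 2)%:E.

Definition jump_energy u : \bar R :=
  \int[Hmeas n n.-1]_(x in jump_set u `&` @half_open_cell R n)
    (mxnorm (jump_height u x))%:E.

Definition f_hom A B K0 xi : \bar R :=
  ereal_inf [set z | exists u e,
    admissible B K0 xi u e /\ z = bulk_energy A e + jump_energy u].

Definition g_hom A B K0 xi : \bar R :=
  ereal_inf [set z | exists u e,
    admissible B K0 xi u e /\ z = bulk_energy A e].

Definition H_hom A B K0 : set 'M[R]_n :=
  [set xi | Msym xi /\ g_hom A B K0 xi = 0].

End homogenization.

(* Main.v *)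
(* Averaging over a period gives, for admissible [u],
     xi = int_Y e dx + int_(J_u, [0,1)^n) (u^+ - u^-) (.) nu dH^(n-1).
   Pairing with an interior point [eta] of the orthogonal cone, where
   [(T, eta) <= - s |T|] on [K_0], and using [|a| <= 2 |a (.) nu|] for unit [nu],
   the jump energy is at most a constant times [|xi| + int_Y |e|].  The last
   integral is controlled by the bulk energy, whose infimum is 0 on [H_hom].

   The mean value identity comes from testing [Eu] against smooth cutoffs [phi]
   converging to the indicator of [0,1)^n.  Each [d_j phi] is the difference of
   a function and its translate by [e_j], so that the periodicity of
   [u - u_xi] leaves only the contribution of [xi]. *)
Require Import Defs.
From HB Require Import structures.
From mathcomp Require Import all_boot all_order all_algebra.
From mathcomp Require Import all_classical all_reals all_analysis.
From mathcomp Require Import measurable_realfun.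
From mathcomp Require Import lra ring.

Set Implicit Arguments.
Unset Strict Implicit.
Unset Printing Implicit Defensive.

Import Order.TTheory GRing.Theory Num.Theory.
Import numFieldNormedType.Exports.

Local Open Scope classical_set_scope.
Local Open Scope ring_scope.

(** * Caratheodory measurability for Hausdorff measures *)

(** The jump part of [Eu] is given through integrals against H^(n-1) on its Caratheodory
    sigma-algebra, so nothing can be integrated over the cell before the cell is known to be
    Caratheodory-measurable. Cells and sup-norm balls are intersections of coordinate half-spaces;
    hence it is enough that the outer measure is additive on sets separated by one coordinate. This
    is Caratheodory's metric criterion with a coordinate function in place of the distance.

    [Eu] may charge the faces of the cell. The cutoffs must therefore converge at every point to the
    indicator of the half-open cell: with convergence outside a Lebesgue-null set only, jumps on the
    faces could be lost or counted twice.

    The final constant depends on [eta] and [s] alone. Two errors remain, one from the parameter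
    [tau] in Young's inequality and one from the bulk energy of the competitor. Both are made small
    for fixed [xi], and [tau] is fixed before the competitor because [1 / tau] multiplies the bulk
    energy. *)

Section caratheodory_criterion.
Context {R : realType} {T : Type} (mu : {outer_measure set T -> \bar R}).
Variable g : T -> R.
Hypothesis sep_additive : forall (P Q : set T) (r : R), 0 < r ->
  (forall x y, P x -> Q y -> g x + r <= g y) ->
  (mu P + mu Q <= mu (P `|` Q))%E.
Local Open Scope ereal_scope.

(** Levels decrease with the index: each new layer lies below all previous ones with the gap
    [lo N - hi N.+1], so separated additivity splits it off. *)
Lemma sep_additive_sum (F : nat -> set T) (lo hi : nat -> R) :
  (forall k, (lo k.+1 < hi k.+1 < lo k)%R) ->
  (forall k x, F k x -> (lo k < g x <= hi k)%R) ->
  forall N, \sum_(0 <= k < N) mu (F k) <= mu (\bigcup_(k in `I_N) F k).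
Proof.
move=> lohi FP.
have lo_decr k m : (k <= m)%N -> (lo m <= lo k)%R.
  elim: m => [|m IH]; first by rewrite leqn0 => /eqP ->.
  rewrite leq_eqVlt ltnS => /orP[/eqP ->//|/IH]; apply: le_trans.
  by have /andP[a b] := lohi m; apply: ltW; exact: lt_trans a b.
elim=> [|N IH]; first by rewrite big_nil outer_measure_ge0.
rewrite big_nat_recr//= IIS bigcup_setU bigcup_set1 setUC addeC.
case: N IH => [|N] IH.
  by rewrite big_nil adde0 II0 bigcup_set0 setU0.
have r0 : (0 < lo N - hi N.+1)%R.
  by rewrite subr_gt0; have /andP[] := lohi N.
apply: (le_trans (leeD2l _ IH)).
apply: (sep_additive r0) => x y Fx [k /= kN Fy].
have /andP[_ hx] := FP _ _ Fx; have /andP[hy _] := FP _ _ Fy.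
have := lo_decr k N kN; rewrite -lerBrDr; lra.
Qed.

(* Every other layer [c k.+1 < g <= c k] is separated from the remaining ones, so
   the measures of the layers are summable; the tail of their series bounds what
   is lost by moving away from the level [a]. *)
Lemma caratheodory_sublevel (a : R) : mu.-caratheodory [set x | (g x <= a)%R].
Proof.
apply: le_caratheodory_measurable => X.
have [->|Xoo] := eqVneq (mu X) +oo; first by rewrite leey.
set E := X `&` _; set F := X `&` _.
pose c k : R := (a + k.+1%:R^-1)%R.
have cS k : (c k.+1 < c k)%R.
  by rewrite ltrD2l ltf_pV2 ?posrE// ltr_nat.
pose S k := X `&` [set x | (c k.+1 < g x <= c k)%R].
have ge0 k : 0 <= mu (S k) by exact: outer_measure_ge0.
have even_le N : \sum_(0 <= k < N) mu (S k.*2) <= mu X.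
  apply: (le_trans (@sep_additive_sum (fun k => S k.*2)
    (fun k => c k.*2.+1) (fun k => c k.*2) _ _ N)).
  - by move=> k; rewrite doubleS !cS.
  - by move=> k x [].
  - by apply: le_outer_measure => x [k _ []].
have odd_le N : \sum_(0 <= k < N) mu (S k.*2.+1) <= mu X.
  apply: (le_trans (@sep_additive_sum (fun k => S k.*2.+1)
    (fun k => c k.*2.+2) (fun k => c k.*2.+1) _ _ N)).
  - by move=> k; rewrite doubleS !cS.
  - by move=> k x [].
  - by apply: le_outer_measure => x [k _ []].
have sumS N : \sum_(0 <= k < N.*2) mu (S k) =
    \sum_(0 <= k < N) mu (S k.*2) + \sum_(0 <= k < N) mu (S k.*2.+1).
  elim: N => [|N IH]; first by rewrite !big_nil adde0.
  by rewrite doubleS !big_nat_recr//= IH addeACA !addeA.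
have Sfin : \sum_(k <oo) mu (S k) < +oo.
  apply: (@le_lt_trans _ _ (mu X + mu X)).
    apply: lime_le; first exact: is_cvg_nneseries.
    near=> N; apply: (@le_trans _ _ (\sum_(0 <= k < N.*2) mu (S k))).
      by apply: lee_sum_nneg_natr => //; rewrite -addnn leq_addr.
    by rewrite sumS leeD.
  by rewrite lte_add_pinfty// ltey.
have Ftail N : mu F <= mu (X `&` [set x | (c N < g x)%R]) +
    \sum_(N <= k <oo) mu (S k).
  apply: (@le_trans _ _ (mu ((X `&` [set x | (c N < g x)%R]) `|`
      \bigcup_(k in ~` `I_N) S k))); last first.
    apply: (le_trans (outer_measureU2 _ _ _)); rewrite leeD2l//.
    exact: outer_measure_sigma_subadditive_tail.
  apply: le_outer_measure => x [Xx /negP]; rewrite -real_ltNge ?num_real// => ax.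
  have [cNx|xcN] := ltP (c N) (g x); first by left.
  right.
  have hex : exists k, (c k < g x)%R.
    have d0 : (0 < g x - a)%R by rewrite subr_gt0.
    have [k _ hk] := near_infty_natSinv_lt (PosNum d0).
    by exists k; rewrite /c -ltrBrDl; apply: hk => /=.
  (* The least [m] with [c m < g x] exceeds [N], so [x] lies in the layer of index [m - 1 >= N]. *)
  case: (ex_minnP hex) => m hm mmin.
  have cW i j : (i <= j)%N -> (c j <= c i)%R.
    by move=> ij; rewrite lerD2l lef_pV2 ?posrE// ler_nat.
  have Nm : (N < m)%N.
    rewrite ltnNge; apply/negP => /cW; rewrite leNgt => /negP; apply.
    exact: lt_le_trans hm xcN.
  case: m => // m in hm mmin Nm *; exists m => //=; first by apply/negP; rewrite -leqNgt.
  split=> //=; rewrite hm/= leNgt; apply/negP => /mmin.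
  by rewrite ltnn.
have main N : mu E + mu F <= mu X + \sum_(N <= k <oo) mu (S k).
  apply: (le_trans (leeD2l _ (Ftail N))); rewrite addeA leeD2r//.
  have N0 : (0 < N.+1%:R^-1 :> R)%R by rewrite invr_gt0.
  apply: (le_trans (sep_additive N0 _)).
    move=> x y [_ /= xa] [_ /= cy]; apply: le_trans (ltW cy).
    by rewrite lerD2r.
  by apply: le_outer_measure => x [] [].
have tail0 := nneseries_tail_cvg Sfin (fun k _ => ge0 k).
have : (fun N => mu X + \sum_(N <= k <oo) mu (S k)) @ \oo --> mu X + 0.
  apply: cvgeD; [|exact: cvg_cst|exact: tail0].
  by rewrite fin_num_adde_defl.
rewrite adde0 => /cvg_lim <-//; apply: lime_ge; last exact: nearW.
by apply/cvg_ex; exists (mu X + 0); apply: cvgeD;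
  [rewrite fin_num_adde_defl|exact: cvg_cst|exact: tail0].
Unshelve. all: by end_near. Qed.

End caratheodory_criterion.

(** * Additivity of Hausdorff measure on sets separated by a coordinate *)

Section hausdorff_measurable.
Context {R : realType}.

Lemma mxdot_ge0 m n (x : 'M[R]_(m, n)) : 0 <= mxdot x x.
Proof.
by apply: sumr_ge0 => i _; apply: sumr_ge0 => j _; rewrite -expr2 sqr_ge0.
Qed.

Lemma ler_normr_mxnorm m n (x : 'M[R]_(m, n)) i j : `|x i j| <= mxnorm x.
Proof.
rewrite -sqrtr_sqr /mxnorm ler_sqrt ?mxdot_ge0// /mxdot (bigD1 i)//= (bigD1 j)//=.
rewrite -expr2 -addrA lerDl addr_ge0//.
  by apply: sumr_ge0 => k _; rewrite -expr2 sqr_ge0.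
by apply: sumr_ge0 => k _; apply: sumr_ge0 => l _; rewrite -expr2 sqr_ge0.
Qed.

Local Open Scope ereal_scope.

(* A set of diameter at most [delta] cannot meet both halves, so a cover of the
   union splits into a cover of each. *)
Lemma mu_ext_hausdorff_weight_sep n s (delta r : R) (j : 'I_n)
    (P Q : set 'rV[R]_n) : (delta < r)%R ->
  (forall x y, P x -> Q y -> (x ord0 j + r <= y ord0 j)%R) ->
  mu_ext (@hausdorff_weight R n s delta) P +
  mu_ext (@hausdorff_weight R n s delta) Q <=
  mu_ext (@hausdorff_weight R n s delta) (P `|` Q).
Proof.
move=> dr sep; set w := @hausdorff_weight R n s delta.
have w0 : w set0 = 0 by exact: hausdorff_weight0.
have wge0 C : 0 <= w C by exact: hausdorff_weight_ge0.
apply: le_ereal_inf_tmp => _ [C [mC PQC] <-].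
pose restr (D : set 'rV[R]_n) k : set (borel R n) :=
  if `[< C k `&` D !=set0 >] then C k else set0.
have mrestr D k : measurable (restr D k) by rewrite /restr; case: ifP.
have crestr D : D `<=` \bigcup_k C k -> D `<=` \bigcup_k restr D k.
  move=> DC x Dx; have [k _ Ckx] := DC _ Dx; exists k => //.
  by rewrite /restr asboolT//; exists x.
have wsum k : w (restr P k) + w (restr Q k) <= w (C k).
  rewrite /restr; case: asboolP => [[x [Cx Px]]|_]; last first.
    by rewrite w0 add0e; case: asboolP => // _; rewrite w0.
  case: asboolP => [[y [Cy Qy]]|_]; last by rewrite w0 adde0.
  suff -> : w (C k) = +oo by rewrite leey.
  rewrite /w /hausdorff_weight asboolF; last first.
    by move=> C0; rewrite C0 in Cx.
  rewrite asboolF// => small; have := small _ _ Cy Cx.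
  rewrite leNgt => /negP; apply; apply: (lt_le_trans dr).
  apply: le_trans (ler_normr_mxnorm _ ord0 j); rewrite !mxE.
  by apply: le_trans (ler_norm _); have := sep _ _ Px Qy; lra.
have bd D : D `<=` \bigcup_k C k -> mu_ext w D <= \sum_(k <oo) w (restr D k).
  move=> DC; apply: ereal_inf_lbound; exists (restr D) => //.
  by split; [exact: mrestr|exact: crestr].
apply: (@le_trans _ _ (\sum_(k <oo) w (restr P k) + \sum_(k <oo) w (restr Q k))).
  by apply: leeD; apply: bd => x Dx; apply: PQC; [left|right].
rewrite -nneseriesD//; apply: lee_nneseries => // k _ _.
by rewrite adde_ge0.
Qed.

(** The approximate measures grow as the scale shrinks, so two scales for [P] and [Q] can be
    replaced by a common one below [r], where covers split. *)
Lemma hausdorff_sep n s (r : R) (j : 'I_n) (P Q : set 'rV[R]_n) : (0 < r)%R ->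
  (forall x y, P x -> Q y -> (x ord0 j + r <= y ord0 j)%R) ->
  Houter n s P + Houter n s Q <= Houter n s (P `|` Q).
Proof.
move=> r0 sep.
(* Finiteness allows the two suprema to be treated one at a time, by moving the other summand across
   the inequality. *)
have [->|PQoo] := eqVneq (Houter n s (P `|` Q)) +oo; first by rewrite leey.
have fin D : D `<=` P `|` Q -> Houter n s D \is a fin_num.
  move=> DPQ; rewrite ge0_fin_numE ?outer_measure_ge0//.
  by apply: (le_lt_trans (le_outer_measure _ _ _ DPQ)); rewrite ltey.
have wmono (d1 d2 : R) D : (d1 <= d2)%R ->
    mu_ext (@hausdorff_weight R n s d2) D <= mu_ext (@hausdorff_weight R n s d1) D.
  move=> d12; apply: le_ereal_inf_tmp => _ [C mC <-].
  apply: (@le_trans _ _ (\sum_(k <oo) @hausdorff_weight R n s d2 (C k))).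
    by apply: ereal_inf_lbound; exists C.
  apply: lee_nneseries => k *; first exact: hausdorff_weight_ge0.
  rewrite /hausdorff_weight; case: ifP => // _.
  case: asboolP => [small|nsmall]; case: asboolP => [small'|nsmall'] //.
    by rewrite leey.
  by case: nsmall => x y Cx Cy; exact: le_trans (small' _ _ Cx Cy) d12.
have finQ : Houter n s Q \is a fin_num by apply: fin => x; right.
have finP : Houter n s P \is a fin_num by apply: fin => x; left.
rewrite -leeBrDr//.
apply: ge_ereal_sup => _ [d1 d10 <-]; rewrite leeBrDr//.
have fin1 : mu_ext (@hausdorff_weight R n s d1) P \is a fin_num.
  rewrite ge0_fin_numE; last exact/mu_ext_ge0/hausdorff_weight_ge0.
  apply: (@le_lt_trans _ _ (Houter n s P)); last first.
    by rewrite -ge0_fin_numE// outer_measure_ge0.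
  by apply: ereal_sup_ubound; exists d1.
rewrite addeC -leeBrDr//.
apply: ge_ereal_sup => _ [d2 d20 <-]; rewrite leeBrDr// addeC.
pose d : R := Num.min (Num.min d1 d2) (r / 2)%R.
have d0 : (0 < d)%R by rewrite !lt_min d10 d20 divr_gt0.
have ler : (d < r)%R.
  by rewrite /d gt_min; apply/orP; right; rewrite ltr_pdivrMr// ltr_pMr// ltr1n.
apply: (@le_trans _ _ (mu_ext (@hausdorff_weight R n s d) P +
                       mu_ext (@hausdorff_weight R n s d) Q)).
  by apply: leeD; apply: wmono; rewrite /d !ge_min lexx ?orbT.
apply: (le_trans (mu_ext_hausdorff_weight_sep s ler sep)).
by apply: ereal_sup_ubound; exists d.
Qed.

Lemma Hmeas_measurable_le n s (j : 'I_n) (a : R) :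
  measurable ([set x : 'rV[R]_n | (x ord0 j <= a)%R] :
    set (caratheodory_type (Houter n s))).
Proof.
apply: (caratheodory_sublevel (g := fun x : 'rV[R]_n => x ord0 j)) => P Q r.
exact: hausdorff_sep.
Qed.

End hausdorff_measurable.

(** * Lebesgue measure on row vectors *)

Section lebesgue_rV.
Context {R : realType}.

Lemma row_consE0 n (p : measurableTypeR R * borel R n) :
  (row_cons p : 'rV[R]_n.+1) 0 0 = p.1.
Proof. by have /(congr1 fst) := row_consK p. Qed.

Lemma row_consE n (p : measurableTypeR R * borel R n) (k : 'I_n) :
  (row_cons p : 'rV[R]_n.+1) 0 (lift ord0 k) = (p.2 : 'rV[R]_n) 0 k.
Proof.
have /(congr1 (fun q => (q.2 : 'rV[R]_n) 0 k)) := row_consK p.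
rewrite /row_uncons /= mxE => <-; congr (row_cons p _ _).
exact: val_inj.
Qed.

Lemma measurable_shift n (v : 'rV[R]_n) :
  measurable_fun [set: borel R n] ((fun x : 'rV[R]_n => x + v) : borel R n -> borel R n).
Proof.
apply: measurable_fun_rV => j; under eq_fun do rewrite mxE.
by apply: measurable_funD; [exact: measurable_coord|exact: measurable_cst].
Qed.

Lemma lebesgue_measure_shift (c : R) (A : set (measurableTypeR R)) : measurable A ->
  lebesgue_measure ((fun t : R => t + c) @^-1` A) = lebesgue_measure A.
Proof.
have msh : measurable_fun [set: measurableTypeR R]
    ((fun t : R => t + c) : measurableTypeR R -> measurableTypeR R).
  by apply: measurable_funD.
pose f : {mfun measurableTypeR R >-> measurableTypeR R} :=
  HB.pack ((fun t : R => t + c) : measurableTypeR R -> measurableTypeR R)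
    (isMeasurableFun.Build _ _ _ _ _ msh).
move=> mA; apply/esym.
apply: (lebesgue_measure_unique (mu := pushforward lebesgue_measure f)) => //.
move=> X [[a b] _ <-].
transitivity (lebesgue_measure ([set` `]a - c, b - c]] : set R)); last first.
  congr (lebesgue_measure _).
  by apply/seteqP; split=> x /=; rewrite !in_itv/= ltrBlDr lerBrDr.
rewrite !lebesgue_measure_itv/= !lte_fin ltrD2r.
by case: ifP => // _; rewrite -!EFinB; congr EFin; ring.
Qed.

(** Under [row_cons] a translation is a product of translations, so uniqueness of the product
    measure reduces the claim to the line and to one dimension less. *)
Lemma leb_shift n (v : 'rV[R]_n) (A : set (borel R n)) : measurable A ->
  leb n ((fun x : 'rV[R]_n => x + v) @^-1` A) = leb n A.
Proof.
elim: n v A => [|n IH] v A mA.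
  by congr (leb 0 _); apply/seteqP; split=> x /=; rewrite (_ : x + v = x)//;
    apply/rowP => -[].
have mpre : measurable (@row_cons R n @^-1` A).
  by rewrite -[X in measurable X]setTI; exact: measurable_row_cons.
pose sh (p : measurableTypeR R * borel R n) : measurableTypeR R * borel R n :=
  (p.1 + v 0 0, (p.2 : 'rV[R]_n) + \row_k v 0 (lift ord0 k)).
have msh : measurable_fun setT sh.
  apply/measurable_fun_pairP; split.
    by apply: measurable_funD; [exact: measurable_fst|exact: measurable_cst].
  by apply: (measurableT_comp (measurable_shift _)); exact: measurable_snd.
pose f : {mfun (measurableTypeR R * borel R n)%type >-> (measurableTypeR R * borel R n)%type} :=
  HB.pack sh (isMeasurableFun.Build _ _ _ _ _ msh).
have shE p : row_cons p + v = row_cons (sh p).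
  apply/rowP => k; case: (unliftP ord0 k) => [k' ->|->];
    by rewrite [LHS]mxE ?row_consE0 ?row_consE//= !mxE.
transitivity ((lebesgue_measure \x leb n)%E (sh @^-1` (@row_cons R n @^-1` A))).
  by congr ((_ \x _)%E _); apply/seteqP; split=> p /=; rewrite shE.
apply/esym; apply: (product_measure_unique (m1 := @lebesgue_measure R) (m2 := leb n)
  (m' := pushforward (lebesgue_measure \x leb n)%E f)) => // C D mC mD.
transitivity ((lebesgue_measure \x leb n)%E
  (((fun t : R => t + v 0 0) @^-1` C) `*`
   ((fun x : 'rV[R]_n => x + \row_k v 0 (lift ord0 k)) @^-1` D))) => //.
have mC' : measurable ((fun t : R => t + v 0 0) @^-1` C : set (measurableTypeR R)).
  rewrite -[X in measurable X]setTI.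
  by apply: measurable_funD.
rewrite product_measure1E//; last first.
  by rewrite -[X in measurable X]setTI; exact: measurable_shift.
by congr (_ * _)%E; [exact: lebesgue_measure_shift|exact: IH].
Qed.

Lemma ge0_leb_integral_shift n (v : 'rV[R]_n) (f : borel R n -> \bar R) :
  measurable_fun [set: borel R n] f -> (forall x, 0 <= f x)%E ->
  (\int[leb n]_x f ((x : 'rV[R]_n) + v)%R = \int[leb n]_x f x)%E.
Proof.
move=> mf f0.
have := ge0_integral_pushforward (measurable_shift v) (leb n) measurableT mf (fun x _ => f0 x).
rewrite preimage_setT => <-.
by apply: eq_measure_integral => [|? A mA _]; [exact: measurable_shift|exact: leb_shift].
Qed.

Lemma leb_integral_shift n (v : 'rV[R]_n) (f : borel R n -> \bar R) :
  measurable_fun [set: borel R n] f ->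
  (\int[leb n]_x f ((x : 'rV[R]_n) + v)%R = \int[leb n]_x f x)%E.
Proof.
move=> mf; rewrite integralE [RHS]integralE; congr (_ - _)%E.
  rewrite -[RHS](ge0_leb_integral_shift v) //; last 1 first.
  - exact: measurable_funepos.
  by apply: eq_integral => x _; rewrite !funeposE.
rewrite -[RHS](ge0_leb_integral_shift v) //; last 1 first.
- exact: measurable_funeneg.
by apply: eq_integral => x _; rewrite !funenegE.
Qed.

Lemma measurable_prod_coord n (f : 'I_n -> R -> R) :
  (forall k, measurable_fun setT (f k : measurableTypeR R -> measurableTypeR R)) ->
  measurable_fun [set: borel R n] (fun x : borel R n => (\prod_k f k ((x : 'rV[R]_n) 0 k))).
Proof.
move=> mf; apply: measurable_prod => k _.
exact: measurableT_comp (mf k) (measurable_coord k).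
Qed.

(** Tonelli in the first coordinate. With indicators it gives volumes of boxes, with smooth factors
    the mass of the slabs below. *)
Lemma leb_integral_prod n (f : 'I_n -> R -> R) (c : 'I_n -> R) :
  (forall k, measurable_fun setT (f k : measurableTypeR R -> measurableTypeR R)) ->
  (forall k t, 0 <= f k t) ->
  (forall k, (\int[lebesgue_measure]_t (f k t)%:E = (c k)%:E)%E) ->
  (\int[leb n]_x (\prod_k f k ((x : 'rV[R]_n) 0 k))%:E = (\prod_k c k)%:E)%E.
Proof.
elim: n f c => [|n IH] f c mf f0 fc.
  rewrite /= integral_dirac//; last by apply/measurable_EFinP; exact: measurable_prod_coord.
  by rewrite diracT mul1e !big_ord0.
have mF : measurable_fun [set: borel R n.+1]
    (fun x : borel R n.+1 => (\prod_k f k ((x : 'rV[R]_n.+1) 0 k))%:E).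
  by apply/measurable_EFinP; exact: measurable_prod_coord.
transitivity (\int[(lebesgue_measure \x leb n)%E]_p
    ((fun x : borel R n.+1 => (\prod_k f k ((x : 'rV[R]_n.+1) 0 k))%:E) \o @row_cons R n) p)%E.
  rewrite -[in RHS](preimage_setT (@row_cons R n)).
  rewrite -ge0_integral_pushforward//; first exact: measurable_row_cons.
  by move=> x _; rewrite lee_fin prodr_ge0.
rewrite fubini_tonelli1; last 2 first.
- by apply: measurableT_comp => //; exact: measurable_row_cons.
- by move=> p; rewrite lee_fin prodr_ge0.
rewrite /fubini_F /=.
transitivity (\int[lebesgue_measure]_t ((\prod_k c (lift ord0 k))%:E * (f ord0 t)%:E))%E.
  apply: eq_integral => t _.
  transitivity (\int[leb n]_y ((f ord0 t)%:E *
      (\prod_k f (lift ord0 k) ((y : 'rV[R]_n) 0 k))%:E))%E.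
    apply: eq_integral => y _; rewrite big_ord_recl row_consE0/= -EFinM; congr (_ * _)%:E.
    by apply: eq_bigr => k _; rewrite row_consE.
  rewrite ge0_integralZl//; last 3 first.
  - by apply/measurable_EFinP; exact: (@measurable_prod_coord _ (fun k => f (lift ord0 k))).
  - by move=> y _; rewrite lee_fin prodr_ge0.
  - by rewrite lee_fin.
  by rewrite (IH (fun k => f (lift ord0 k)) (fun k => c (lift ord0 k)))// muleC.
rewrite ge0_integralZl//; last 3 first.
- by apply/measurable_EFinP; exact: mf.
- by move=> t _; rewrite lee_fin.
- rewrite lee_fin prodr_ge0// => k _; rewrite -lee_fin -fc.
  by apply: integral_ge0 => t _; rewrite lee_fin.
by rewrite fc -EFinM mulrC big_ord_recl.
Qed.

Lemma prod_indic n (I : set R) (x : 'rV[R]_n) :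
  \prod_k \1_I (x 0 k) = \1_[set y : 'rV[R]_n | forall k, I (y 0 k)] x :> R.
Proof.
rewrite indicE; have [hx|hx] := pselect (forall k, I (x 0 k)).
  by rewrite mem_set//= big1// => k _; rewrite indicE mem_set.
have /existsNP[k hk] := hx.
by rewrite memNset// (bigD1 k)//= indicE memNset// mul0r.
Qed.

Lemma measurable_box n (I : set (measurableTypeR R)) : measurable I ->
  measurable ([set x : 'rV[R]_n | forall k, I (x 0 k)] : set (borel R n)).
Proof.
move=> mI; rewrite (_ : mkset _ =
  \bigcap_(k in [set: 'I_n]) ((fun x : 'rV[R]_n => x 0 k) @^-1` I)).
  apply: fin_bigcap_measurable; first exact: finite_finset.
  by move=> k _; rewrite -[X in measurable X]setTI; exact: measurable_coord.
by apply/seteqP; split=> x h k => [_|]; [exact: h|exact: h].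
Qed.

Lemma leb_box n (I : set (measurableTypeR R)) (c : R) : measurable I ->
  lebesgue_measure I = c%:E ->
  leb n ([set x : 'rV[R]_n | forall k, I (x 0 k)]) = (c ^+ n)%:E.
Proof.
move=> mI Ic; set D := mkset _.
transitivity (\int[leb n]_x (\1_D x)%:E)%E.
  by rewrite integral_indic ?setIT//; exact: measurable_box.
under eq_integral do rewrite -prod_indic.
rewrite (@leb_integral_prod n (fun=> \1_I) (fun=> c)) ?prodr_const ?card_ord//.
by move=> k; rewrite integral_indic ?setIT.
Qed.

Lemma open_cellE n :
  @open_cell R n = [set x | forall k, [set` `]0, 1[%R] (x 0 k)].
Proof.
by apply/seteqP; split=> x h k; have := h k; rewrite /= in_itv.
Qed.

Lemma half_open_cellE n :
  @half_open_cell R n = [set x | forall k, [set` `[0, 1[%R] (x 0 k)].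
Proof.
by apply/seteqP; split=> x h k; have := h k; rewrite /= in_itv.
Qed.

Lemma measurable_open_cell n : measurable (@open_cell R n : set (borel R n)).
Proof. by rewrite open_cellE; exact: measurable_box. Qed.

Lemma measurable_half_open_cell n :
  measurable (@half_open_cell R n : set (borel R n)).
Proof. by rewrite half_open_cellE; exact: measurable_box. Qed.

Lemma open_cell_sub n : @open_cell R n `<=` @half_open_cell R n.
Proof. by move=> x h k; have /andP[/ltW -> ->] := h k. Qed.

Lemma leb_open_cell n : leb n (@open_cell R n) = 1%E.
Proof.
rewrite open_cellE (@leb_box _ _ 1) ?expr1n//.
by rewrite lebesgue_measure_itv/= lte01 sube0.
Qed.

(** The bulk energy lives on the open cell, the mean value identity on the half-open one; this
    reconciles them in integrals of [e]. *)
Lemma leb_cellD n : leb n (@half_open_cell R n `\` @open_cell R n) = 0%E.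
Proof.
have h1 : leb n (@half_open_cell R n) = 1%E.
  rewrite half_open_cellE (@leb_box _ _ 1) ?expr1n//.
  by rewrite lebesgue_measure_itv/= lte01 sube0.
rewrite measureD//=; last 3 first.
- exact: measurable_half_open_cell.
- exact: measurable_open_cell.
- by rewrite h1 ltry.
rewrite setIidr; last exact: open_cell_sub.
by rewrite h1 leb_open_cell subee.
Qed.

End lebesgue_rV.

(** * A smooth step function *)

Section smooth_step.
Context {R : realType}.
Implicit Types (f g dg : R -> R) (p : {poly R}).

(** One-variable counterpart of [Ck]. Continuity is not recorded but follows from the next
    derivative, whence the extra order in [Ck_prod_fun]. *)
Fixpoint smooth_upto (k : nat) g : Prop :=
  match k with
  | 0 => True
  | k'.+1 => (forall t : R, derivable g t 1) /\ smooth_upto k' (derive1 g)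
  end.

Lemma derive1_is_derive g dg : (forall t : R, is_derive t (1:R) g (dg t)) ->
  (forall t : R, derivable g t 1) /\ (derive1 g) = dg.
Proof.
move=> gdg; split=> [t|]; first by have [] := gdg t.
by apply/funext => t; rewrite derive1E; have [_ ->] := gdg t.
Qed.

Lemma smooth_uptoS k g dg : (forall t : R, is_derive t (1:R) g (dg t)) ->
  smooth_upto k dg -> smooth_upto k.+1 g.
Proof. by move=> /derive1_is_derive[dg1 dgE] sdg; split; rewrite ?dgE. Qed.

Lemma derivable_is_derive1 g : (forall t : R, derivable g t 1) ->
  forall t : R, is_derive t (1:R) g ((derive1 g) t).
Proof. by move=> dg t; split=> //; rewrite derive1E. Qed.

Lemma smooth_uptoW k g : smooth_upto k.+1 g -> smooth_upto k g.
Proof.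
elim: k g => [//|k IH] g [dg sg]; split=> //.
exact: IH.
Qed.

Lemma smooth_upto_cst k (c : R) : smooth_upto k (fun=> c).
Proof.
elim: k c => [//|k IH] c; apply: (@smooth_uptoS _ _ (fun=> 0)); last exact: IH.
Qed.

Lemma smooth_uptoD k f g : smooth_upto k f -> smooth_upto k g ->
  smooth_upto k (fun t => f t + g t).
Proof.
elim: k f g => [//|k IH] f g [df sf] [dg sg].
apply: (@smooth_uptoS _ _ (fun t => (derive1 f) t + (derive1 g) t)); last exact: IH.
move=> t; have ? := derivable_is_derive1 df t; have ? := derivable_is_derive1 dg t.
exact: is_deriveD.
Qed.

Lemma smooth_uptoM k f g : smooth_upto k f -> smooth_upto k g ->
  smooth_upto k (fun t => f t * g t).
Proof.
elim: k f g => [//|k IH] f g sf sg.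
have [df sf'] := sf; have [dg sg'] := sg.
apply: (@smooth_uptoS _ _ (fun t => f t * (derive1 g) t + g t * (derive1 f) t)).
  move=> t; have ? := derivable_is_derive1 df t; have ? := derivable_is_derive1 dg t.
  exact: is_deriveM.
by apply: smooth_uptoD; apply: IH => //; exact: smooth_uptoW.
Qed.

(** The derivative of [1/f] contains [1/f] again, so the induction is on [k] with [f] fixed. *)
Lemma smooth_uptoV k f : (forall t, f t != 0) -> smooth_upto k f ->
  smooth_upto k (fun t => (f t)^-1).
Proof.
move=> f0; elim: k => [//|k IH] sf; have [df sf'] := sf.
apply: (@smooth_uptoS _ _ (fun t => - 1 * ((f t)^-1 * (f t)^-1 * (derive1 f) t))).
  move=> t; have ? := derivable_is_derive1 df t.
  apply: (is_derive_eq (is_deriveV (f0 t) _)).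
  by rewrite /GRing.scale/= expr2 invfM; ring.
have ? := IH (smooth_uptoW sf).
by apply: smooth_uptoM; [exact: smooth_upto_cst|do 2 ?apply: smooth_uptoM].
Qed.

Lemma is_derive_affine (a b t : R) : is_derive t (1:R) (fun t => a * t + b) a.
Proof.
apply: (is_derive_eq (is_deriveD (is_deriveZ a (is_derive_id t 1)) (is_derive_cst b t 1))).
by rewrite addr0 /GRing.scale/= mulr1.
Qed.

Lemma is_derive_comp_affine g (a b t dg : R) : is_derive (a * t + b) (1:R) g dg ->
  is_derive t (1:R) (fun t => g (a * t + b)) (a * dg).
Proof.
move=> gdg; rewrite mulrC.
exact: (@is_derive1_comp _ g (fun t => a * t + b) t _ _ gdg (is_derive_affine a b t)).
Qed.

Lemma smooth_upto_affine k g (a b : R) : smooth_upto k g ->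
  smooth_upto k (fun t => g (a * t + b)).
Proof.
elim: k g => [//|k IH] g [dg sg].
apply: (@smooth_uptoS _ _ (fun t => a * (derive1 g) (a * t + b))); last first.
  by apply: smooth_uptoM; [exact: smooth_upto_cst|exact: IH].
by move=> t; apply: is_derive_comp_affine; exact: derivable_is_derive1.
Qed.

(* The functions [p(1/t) exp(-1/t)], extended by 0, form a family closed under
   differentiation; hence they are smooth. *)
Definition flat_exp p (t : R) : R :=
  if 0 < t then p.[t^-1] * expR (- t^-1) else 0.

(** With [s = 1/t], the chain rule gives [d/dt (p(s) exp(-s)) = s^2 (p(s) - p'(s)) exp(-s)]. *)
Definition flat_exp_deriv p : {poly R} := 'X^2 * (p - p^`()).

Lemma expr_expRN_le (n : nat) (y : R) : 0 <= y -> y ^+ n * expR (- y) <= n`!%:R.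
Proof.
move=> y0; rewrite expRN ler_pdivrMr ?expR_gt0//.
case: n => [|n]; first by rewrite expr0 mul1r; apply: le_trans (expR_ge1Dx y); rewrite lerDl.
rewrite mulrC -ler_pdivrMr; last by rewrite ltr0n fact_gt0.
by apply: le_trans (expR_ge1Dxn n y0); rewrite lerDr.
Qed.

(** A quadratic bound makes the difference quotient at 0 vanish. Dividing [t^-i exp(-1/t)] by [t^2]
    raises the exponent to [i + 2], and the exponential series bounds the result by [(i + 2)!]. *)
Lemma flat_exp_le p : exists2 C, 0 <= C & forall t, `|flat_exp p t| <= C * t ^+ 2.
Proof.
exists (\sum_(i < size p) `|p`_i| * i.+2`!%:R).
  by apply: sumr_ge0 => i _; rewrite mulr_ge0.
move=> t; rewrite /flat_exp; case: ifPn => [t0|_]; last first.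
  by rewrite normr0 mulr_ge0 ?sqr_ge0// sumr_ge0// => i _; rewrite mulr_ge0.
rewrite horner_coef mulr_suml mulr_suml.
apply: (le_trans (ler_norm_sum _ _ _)); apply: ler_sum => i _.
rewrite !normrM -!mulrA ler_wpM2l//.
have ti0 : 0 <= t^-1 by rewrite invr_ge0 ltW.
rewrite (ger0_norm (expR_ge0 _)) ger0_norm ?exprn_ge0//.
rewrite -ler_pdivrMr ?exprn_gt0// -exprVn mulrAC -exprD addn2.
exact: expr_expRN_le.
Qed.

Lemma is_derive_flat_exp p t :
  is_derive t (1:R) (flat_exp p) (flat_exp (flat_exp_deriv p) t).
Proof.
have [t0|t0|t0] := ltgtP 0 t.
- have tn0 : t != 0 by rewrite gt_eqF.
  have d1 : is_derive t (1:R) (fun s : R => s^-1) (- t ^- 2 *: 1).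
    exact: (@is_deriveV _ id t 1 1 tn0 (is_derive_id t 1)).
  have d2 : is_derive t (1:R) (fun s : R => - s^-1) (- (- t ^- 2 *: 1)).
    exact: is_deriveN.
  have d3 : is_derive t (1:R) (fun s : R => expR (- s^-1)) (expR (- t^-1) * - (- t ^- 2 *: 1)).
    exact: (@is_derive1_comp _ expR (fun s : R => - s^-1) t _ _ (is_derive_expR _) d2).
  have dp : is_derive t^-1 (1:R) (horner p) (p^`().[t^-1]).
    by split; [exact: derivable_horner|rewrite -derive1E -derivE].
  have d4 : is_derive t (1:R) (fun s : R => p.[s^-1]) (p^`().[t^-1] * (- t ^- 2 *: 1)).
    exact: (@is_derive1_comp _ (horner p) (fun s : R => s^-1) t _ _ dp d1).
  apply: (near_eq_is_derive (f := fun s : R => p.[s^-1] * expR (- s^-1))).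
    by near=> s; rewrite /flat_exp ifT//; near: s; exact: lt_nbhsr.
  apply: (is_derive_eq (is_deriveM d4 d3)).
  rewrite /flat_exp t0 /flat_exp_deriv !hornerE /GRing.scale/= exprVn.
  ring.
- apply: (near_eq_is_derive (f := cst 0)).
    near=> s; rewrite /flat_exp ifF//; apply/negbTE; rewrite -leNgt ltW//.
    by near: s; exact: lt_nbhsl.
  by apply: is_derive_eq; rewrite /flat_exp ltNge (ltW t0).
- have [C C0 hC] := flat_exp_le p.
  rewrite -t0 {2}/flat_exp ltxx.
  have cvg0 : (fun h : R => h^-1 *: ((flat_exp p \o shift 0) (h *: 1) - flat_exp p 0))
      @ 0^' --> (0 : R).
    apply/cvgr0Pnorm_le => e e0; near=> h.
    have h0 : h != 0 by near: h; exact: nbhs_dnbhs_neq.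
    rewrite /= [flat_exp p 0]/flat_exp ltxx subr0 addr0 /GRing.scale/= mulr1 normrM normfV.
    rewrite mulrC ler_pdivrMr ?normr_gt0//; apply: (le_trans (hC h)).
    have -> : C * h ^+ 2 = C * `|h| * `|h|.
      by rewrite -mulrA -expr2 real_normK ?num_real.
    rewrite ler_wpM2r//.
    have : `|h| <= e / (C + 1).
      by near: h; apply: dnbhs0_le; rewrite divr_gt0// ltr_wpDl.
    rewrite ler_pdivlMr ?ltr_wpDl// => he; apply: le_trans he.
    by rewrite mulrC ler_wpM2l// lerDl.
  by split; [apply/cvg_ex; exists 0|exact/cvg_lim].
Unshelve. all: by end_near. Qed.

Lemma smooth_flat_exp k p : smooth_upto k (flat_exp p).
Proof.
elim: k p => [//|k IH] p.
exact: smooth_uptoS (is_derive_flat_exp p) (IH _).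
Qed.

Definition flat : R -> R := flat_exp 1.

Lemma flat_ge0 t : 0 <= flat t.
Proof. by rewrite /flat /flat_exp hornerC mul1r; case: ifP => // _; exact: expR_ge0. Qed.

Lemma flat_gt0 t : 0 < t -> 0 < flat t.
Proof. by move=> t0; rewrite /flat /flat_exp hornerC mul1r t0 expR_gt0. Qed.

Lemma flat_le0 t : t <= 0 -> flat t = 0.
Proof. by move=> t0; rewrite /flat /flat_exp ltNge t0. Qed.

Let denom (t : R) : R := flat t + flat (-1 * t + 1).

Let denom_gt0 t : 0 < denom t.
Proof.
rewrite /denom; have [t0|t0] := ltP 0 t.
  by rewrite ltr_pwDl ?flat_gt0// flat_ge0.
by rewrite ltr_wpDl ?flat_ge0// flat_gt0//; lra.
Qed.

Definition smooth_step (t : R) : R := flat t * (denom t)^-1.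

Lemma smooth_smooth_step k : smooth_upto k smooth_step.
Proof.
apply: smooth_uptoM; first exact: smooth_flat_exp.
apply: smooth_uptoV; first by move=> t; rewrite gt_eqF.
by apply: smooth_uptoD; [|apply: smooth_upto_affine]; exact: smooth_flat_exp.
Qed.

Lemma smooth_step_le0 t : t <= 0 -> smooth_step t = 0.
Proof. by move=> t0; rewrite /smooth_step flat_le0// mul0r. Qed.

Lemma smooth_step_ge1 t : 1 <= t -> smooth_step t = 1.
Proof.
move=> t1; have := denom_gt0 t; rewrite /smooth_step /denom.
rewrite (@flat_le0 (-1 * t + 1)); last by lra.
by rewrite addr0 => d0; rewrite divff// gt_eqF.
Qed.

(** The quotient rule leaves [f(t) f'(1-t) + f(1-t) f'(t)] over a square, where [f] is [flat]; both
    terms are non-negative. The sign is what lets Tonelli be applied to the slabs. *)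
Lemma smooth_step_deriv_ge0 t : 0 <= derive1 smooth_step t.
Proof.
have h0 s : 0 <= flat_exp (flat_exp_deriv 1) s.
  rewrite /flat_exp /flat_exp_deriv derivC subr0 mulr1 hornerXn.
  by case: ifP => // _; rewrite mulr_ge0 ?expR_ge0// sqr_ge0.
have d1 : is_derive t (1:R) flat (flat_exp (flat_exp_deriv 1) t).
  exact: is_derive_flat_exp.
have d2 : is_derive t (1:R) (fun s => flat (-1 * s + 1))
    (-1 * flat_exp (flat_exp_deriv 1) (-1 * t + 1)).
  by apply: is_derive_comp_affine; exact: is_derive_flat_exp.
have d3 : is_derive t (1:R) denom (flat_exp (flat_exp_deriv 1) t +
    -1 * flat_exp (flat_exp_deriv 1) (-1 * t + 1)) by exact: is_deriveD.
have dn0 : denom t != 0 by rewrite gt_eqF.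
have d4 := @is_deriveV _ denom _ _ _ dn0 d3.
have [_ ds] := is_deriveM d1 d4.
have -> : smooth_step = flat * (fun s => (denom s)^-1) by [].
rewrite derive1E ds.
set a := flat_exp _ t; set b := flat_exp _ (-1 * t + 1).
have -> : flat t *: (- denom t ^- 2 *: (a + -1 * b)) + (denom t)^-1 *: a =
    denom t ^- 2 * (flat t * b + flat (-1 * t + 1) * a).
  rewrite /GRing.scale/=; have : denom t = flat t + flat (-1 * t + 1) by [].
  by move: dn0; move: (denom t) => D D0 DE; have -> : flat (-1 * t + 1) = D - flat t;
    [rewrite DE; ring|field].
by rewrite mulr_ge0 ?invr_ge0 ?sqr_ge0// addr_ge0// mulr_ge0 ?flat_ge0 ?h0.
Qed.

Lemma smooth_step_ge0 t : 0 <= smooth_step t.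
Proof. by rewrite /smooth_step divr_ge0 ?flat_ge0// ltW. Qed.

Lemma smooth_step_le1 t : smooth_step t <= 1.
Proof.
by rewrite /smooth_step ler_pdivrMr// mul1r lerDl flat_ge0.
Qed.

End smooth_step.

(** * Cutoff functions *)

Section periodic_cutoff.
Context {R : realType}.
Local Notation mu := (@lebesgue_measure R).

(** The rise takes place on [[-1/(m+1), 0]], entirely to the left of 0. Hence [cutoff1] is 1 at 0
    and 0 at 1, and its limit is the indicator of [[0,1)] at the end points too. *)
Definition step_at (m : nat) (t : R) : R := smooth_step (m.+1%:R * t + 1).
(* [S t - S (t - 1)], with affine arguments spelled out for [smooth_upto_affine] *)
Definition cutoff1 (m : nat) (t : R) : R := step_at m t + -1 * step_at m (1 * t + -1).
Definition dstep (m : nat) : R -> R := derive1 (step_at m).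

Lemma smooth_step_at k m : smooth_upto k (step_at m).
Proof. by apply: smooth_upto_affine; exact: smooth_smooth_step. Qed.

Lemma is_derive_step_at m (t : R) : is_derive t (1:R) (step_at m) (dstep m t).
Proof. by apply: derivable_is_derive1; case: (smooth_step_at 1 m). Qed.

Lemma smooth_dstep k m : smooth_upto k (dstep m).
Proof. by case: (smooth_step_at k.+1 m). Qed.

Lemma smooth_cutoff1 k m : smooth_upto k (cutoff1 m).
Proof.
apply: smooth_uptoD; first exact: smooth_step_at.
apply: smooth_uptoM; first exact: smooth_upto_cst.
by apply: smooth_upto_affine; exact: smooth_step_at.
Qed.

Lemma is_derive_cutoff1 m (t : R) :
  is_derive t (1:R) (cutoff1 m) (dstep m t - dstep m (t - 1)).
Proof.
have d1 := is_derive_step_at m t.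
have d2 := is_derive_comp_affine (is_derive_step_at m (1 * t + -1)).
apply: (is_derive_eq (is_deriveD d1 (is_deriveZ (-1) d2))).
by rewrite /GRing.scale/= !mul1r mulN1r.
Qed.

Lemma dstep_ge0 m t : 0 <= dstep m t.
Proof.
have ds : is_derive (m.+1%:R * t + 1) (1:R) (@smooth_step R)
    (derive1 smooth_step (m.+1%:R * t + 1)).
  by apply: derivable_is_derive1; case: (@smooth_smooth_step R 1).
rewrite /dstep derive1E; have [_ ->] := is_derive_comp_affine ds.
by rewrite mulr_ge0// smooth_step_deriv_ge0.
Qed.

Lemma step_at_le0 m t : t <= - m.+1%:R^-1 -> step_at m t = 0.
Proof.
move=> t0; rewrite /step_at smooth_step_le0//.
have m0 : 0 < m.+1%:R :> R by [].
by rewrite -lerBrDr sub0r mulrC -ler_pdivlMr// mulN1r.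
Qed.

Lemma step_at_ge0 m t : 0 <= t -> step_at m t = 1.
Proof. by move=> t0; rewrite /step_at smooth_step_ge1// lerDr mulr_ge0. Qed.

Lemma invS_le1 m : m.+1%:R^-1 <= 1 :> R.
Proof. by rewrite invf_le1// ler1n. Qed.

Lemma dstep_eq0 m t : 1 < `|t| -> dstep m t = 0.
Proof.
rewrite lter_normr => /orP[t1|t1]; rewrite /dstep derive1E.
  rewrite -(@near_eq_derive R R R (cst 1)) ?derive_cst//.
  near=> s; rewrite step_at_ge0//; apply/ltW.
  by near: s; apply: lt_nbhsr; rewrite (lt_trans _ t1).
rewrite -(@near_eq_derive R R R (cst 0)) ?derive_cst//.
near=> s; rewrite step_at_le0//; apply: (@le_trans _ _ (-1)); last first.
  by rewrite lerN2 invS_le1.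
apply/ltW; near: s; apply: lt_nbhsl; lra.
Unshelve. all: by end_near. Qed.

Lemma cutoff1_le0E m t : t <= 0 -> cutoff1 m t = step_at m t.
Proof.
move=> t0; rewrite /cutoff1 (@step_at_le0 m (1 * t + -1)) ?mulr0 ?addr0//.
by rewrite mul1r (@le_trans _ _ (-1))// ?lerN2 ?invS_le1//; lra.
Qed.

Lemma cutoff1_ge0E m t : 0 <= t -> cutoff1 m t = 1 - step_at m (t - 1).
Proof. by move=> t0; rewrite /cutoff1 step_at_ge0// mul1r mulN1r. Qed.

Lemma cutoff1_ge0 m t : 0 <= cutoff1 m t.
Proof.
have [t0|/ltW t0] := leP t 0; first by rewrite cutoff1_le0E// smooth_step_ge0.
by rewrite cutoff1_ge0E// subr_ge0 smooth_step_le1.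
Qed.

Lemma cutoff1_le1 m t : cutoff1 m t <= 1.
Proof.
have [t0|/ltW t0] := leP t 0; first by rewrite cutoff1_le0E// smooth_step_le1.
by rewrite cutoff1_ge0E// gerBl smooth_step_ge0.
Qed.

Lemma cutoff1_eq0 m t : 1 < `|t| -> cutoff1 m t = 0.
Proof.
rewrite lter_normr => /orP[t1|t1].
  by rewrite cutoff1_ge0E ?step_at_ge0 ?subrr//; lra.
rewrite cutoff1_le0E ?step_at_le0//; last by lra.
by rewrite (@le_trans _ _ (-1)) ?lerN2 ?invS_le1//; lra.
Qed.

Lemma cutoff1_near t : \forall m \near \oo, cutoff1 m t = \1_[set` `[0, 1[] t.
Proof.
have step0 s : s < 0 -> \forall m \near \oo, step_at m s = 0.
  move=> s0; have Ns0 : 0 < - s by rewrite oppr_gt0.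
  near=> m; apply: step_at_le0; rewrite lerNr; apply: ltW.
  by near: m; exact: (near_infty_natSinv_lt (PosNum Ns0)).
rewrite indicE; have [t0|t0] := ltP t 0.
  near=> m; rewrite memNset; last by rewrite /= in_itv/= leNgt t0.
  by rewrite cutoff1_le0E ?(ltW t0)//; near: m; exact: step0.
have [t1|t1] := ltP t 1.
  near=> m; rewrite mem_set/=; last by rewrite in_itv/= t0.
  rewrite cutoff1_ge0E// (_ : step_at _ _ = 0) ?subr0//.
  by near: m; apply: step0; rewrite subr_lt0.
near=> m; rewrite memNset; last by rewrite /= in_itv/= t0/= ltNge t1.
by rewrite cutoff1_ge0E// step_at_ge0 ?subrr ?subr_ge0.
Unshelve. all: by end_near. Qed.

Lemma smooth_upto_continuous (g : R -> R) : smooth_upto 1 g -> continuous g.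
Proof.
move=> [dg _] t; apply: differentiable_continuous.
exact/derivable1_diffP.
Qed.

Lemma measurable_smooth (g : R -> R) : smooth_upto 1 g ->
  measurable_fun setT (g : measurableTypeR R -> measurableTypeR R).
Proof. by move=> sg; apply: continuous_measurable_fun; exact: smooth_upto_continuous. Qed.

Lemma integral_dstep m : (\int[mu]_t (dstep m t)%:E = 1)%E.
Proof.
transitivity (\int[mu]_(t in `[(-2)%R, 2%R]) (dstep m t)%:E)%E.
  rewrite [RHS]integral_mkcond; apply: eq_integral => t _.
  rewrite /patch; case: ifPn => // /negP; rewrite inE/= in_itv/= => /negP t2.
  rewrite dstep_eq0// ltNge; apply: contra t2; rewrite ler_norml => /andP[]; lra.
rewrite (@continuous_FTC2 _ (dstep m) (step_at m)).
- rewrite (@step_at_le0 m (-2)) ?step_at_ge0 ?sube0//.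
  by rewrite (@le_trans _ _ (-1)) ?lerN2 ?invS_le1//; lra.
- lra.
- apply: continuous_subspaceT; apply: smooth_upto_continuous.
  exact: smooth_dstep.
- have cs : continuous (step_at m) by apply: smooth_upto_continuous; exact: smooth_step_at.
  split; first by move=> t _; have [] := is_derive_step_at m t.
  + by apply: cvg_at_right_filter; exact: cs.
  + by apply: cvg_at_left_filter; exact: cs.
- by [].
Qed.

Lemma integral_indic_itvN1 : (\int[mu]_t (\1_[set` `[(-1)%R, 1%R]] t)%:E < +oo)%E.
Proof.
rewrite integral_indic// setIT.
have /= -> := @lebesgue_measure_itv R `[(-1)%R, 1%R].
by case: ifP; rewrite ?ltry// -EFinD ltry.
Qed.

Lemma integral_cutoff1_fin m : (\int[mu]_t (cutoff1 m t)%:E \is a fin_num)%E.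
Proof.
rewrite ge0_fin_numE; last by apply: integral_ge0 => t _; rewrite lee_fin cutoff1_ge0.
apply: (@le_lt_trans _ _ (\int[mu]_t (\1_[set` `[(-1)%R, 1%R]] t)%:E)%E).
  apply: ge0_le_integral => //.
  - by move=> t _; rewrite lee_fin cutoff1_ge0.
  - by apply/measurable_EFinP; apply: measurable_smooth; exact: smooth_cutoff1.
  - by apply/measurable_EFinP; exact: measurable_indic.
  move=> t _; rewrite lee_fin indicE; case: (boolP (t \in _)) => [_|/negP]; first exact: cutoff1_le1.
  rewrite inE/= in_itv/= => /negP t2; rewrite cutoff1_eq0// ltNge.
  by apply: contra t2; rewrite ler_norml.
exact: integral_indic_itvN1.
Qed.

Definition cutoff1_mass m : R := fine (\int[mu]_t (cutoff1 m t)%:E)%E.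

Lemma integral_cutoff1 m : (\int[mu]_t (cutoff1 m t)%:E = (cutoff1_mass m)%:E)%E.
Proof. by rewrite fineK// integral_cutoff1_fin. Qed.

Lemma cvg_cutoff1_mass : cutoff1_mass m @[m --> \oo] --> (1 : R).
Proof.
suff /fine_cvgP[] : (\int[mu]_t (cutoff1 m t)%:E)%E @[m --> \oo] --> 1%:E by [].
rewrite (_ : 1%:E = \int[mu]_t (\1_[set` `[0%R, 1%R[] t)%:E)%E; last first.
  rewrite integral_indic// setIT; have /= -> := @lebesgue_measure_itv R `[0%R, 1%R[.
  by rewrite lte01 sube0.
apply: (@dominated_cvg _ _ _ mu setT measurableT (fun m t => (cutoff1 m t)%:E) _
  (fun t => (\1_[set` `[(-1)%R, 1%R]] t)%:E)) => //.
- by move=> m; apply/measurable_EFinP; apply: measurable_smooth; exact: smooth_cutoff1.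
- move=> t _; apply: cvg_near_cst.
  by apply: filterS (cutoff1_near t) => m ->.
- apply/integrableP; split; first by apply/measurable_EFinP; exact: measurable_indic.
  under eq_integral do rewrite gee0_abs ?lee_fin//.
  exact: integral_indic_itvN1.
- move=> m t _; rewrite abse_EFin lee_fin ger0_norm ?cutoff1_ge0// indicE.
  case: (boolP (t \in _)) => [_|/negP]; first exact: cutoff1_le1.
  rewrite inE/= in_itv/= => /negP t2; rewrite cutoff1_eq0// ltNge.
  by apply: contra t2; rewrite ler_norml.
Qed.

End periodic_cutoff.

(** * Tensor products of one-variable cutoffs and their partial derivatives *)

Section product_cutoff.
Context {R : realType} (n : nat).
Implicit Types (f : 'I_n -> R -> R) (x : 'rV[R]_n).

Definition prod_fun f x : R := \prod_k f k (x 0 k).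

Definition upd f (j : 'I_n) (g : R -> R) : 'I_n -> R -> R :=
  fun k => if k == j then g else f k.

Lemma prod_fun_upd f j g x :
  prod_fun (upd f j g) x = g (x 0 j) * \prod_(k | k != j) f k (x 0 k).
Proof.
rewrite /prod_fun (bigD1 j)//= /upd eqxx; congr (_ * _).
by apply: eq_bigr => k /negbTE ->.
Qed.

Lemma prod_funD1 f j x :
  prod_fun f x = f j (x 0 j) * \prod_(k | k != j) f k (x 0 k).
Proof. by rewrite /prod_fun (bigD1 j). Qed.

Lemma is_derive_prod_fun f j x (d : R) : is_derive (x 0 j) (1:R) (f j) d ->
  is_derive x (delta_mx 0 j : 'rV[R]_n) (prod_fun f)
    (d * \prod_(k | k != j) f k (x 0 k)).
Proof.
move=> [df <-]; set C := \prod_(k | _) _.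
have quotE : (fun h : R => h^-1 *:
    ((prod_fun f \o shift x) (h *: (delta_mx 0 j : 'rV[R]_n)) - prod_fun f x)) =
    (fun h : R => h^-1 *: ((f j \o shift (x 0 j)) (h *: (1:R)) - f j (x 0 j)) * C).
  apply/funext => h; rewrite /= !(prod_funD1 f j) !mxE !eqxx /=.
  rewrite /GRing.scale/= -mulrA mulrBl; congr (_ * (_ * _ - _)).
  apply: eq_bigr => k kj; rewrite !mxE eqxx/= (negbTE kj) /GRing.scale/= mulr0.
  by rewrite add0r.
have cv : (fun h : R => h^-1 *:
    ((prod_fun f \o shift x) (h *: (delta_mx 0 j : 'rV[R]_n)) - prod_fun f x))
    @ 0^' --> 'D_1 (f j) (x 0 j) * C.
  by rewrite quotE; apply: cvgM; [exact: df|exact: cvg_cst].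
by split; [apply/cvg_ex; exists ('D_1 (f j) (x 0 j) * C)|exact: cvg_lim cv].
Qed.

Lemma continuous_prod_fun f : (forall k, continuous (f k)) -> continuous (prod_fun f).
Proof.
move=> cf; rewrite /prod_fun.
elim: (index_enum 'I_n) => [|k s IH] x.
  rewrite (_ : (fun y => _) = cst 1); first exact: cst_continuous.
  by apply/funext => y; rewrite big_nil.
rewrite (_ : (fun y => _) = (fun y : 'rV[R]_n => f k (y 0 k)) *
    (fun y => \prod_(k <- s) f k (y 0 k))).
  apply: continuousM; last exact: IH.
  apply: (@continuous_comp _ _ _ (fun y : 'rV[R]_n => y 0 k) (f k)).
    exact: coord_continuous.
  exact: cf.
by apply/funext => y; rewrite big_cons.
Qed.

(** A partial derivative acts on a single factor, so tensor products are stable under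
    differentiation and the induction never leaves [prod_fun]. *)
Lemma Ck_prod_fun m f : (forall k, smooth_upto m.+1 (f k)) -> Ck m (prod_fun f).
Proof.
elim: m f => [|m IH] f sf; (split; first by apply: continuous_prod_fun => k;
    apply: smooth_upto_continuous; case: (sf k) => df _).
  by [].
move=> j.
have dj x : is_derive x (delta_mx 0 j : 'rV[R]_n) (prod_fun f)
    (prod_fun (upd f j (derive1 (f j))) x).
  rewrite prod_fun_upd; apply: is_derive_prod_fun.
  by apply: derivable_is_derive1; case: (sf j).
split; first by move=> x; case: (dj x).
have -> : partial j (prod_fun f) = prod_fun (upd f j (derive1 (f j))).
  by apply/funext => x; rewrite /partial; case: (dj x).
apply: IH => k; rewrite /upd; case: eqP => _; first by case: (sf j).
exact: smooth_uptoW.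
Qed.

Definition cutoff (m : nat) : 'rV[R]_n -> R := prod_fun (fun=> cutoff1 m).

(** A smoothed surface measure of the face [x_j = 0] of the cell. *)
Definition slab (m : nat) (j : 'I_n) : 'rV[R]_n -> R :=
  prod_fun (upd (fun=> cutoff1 m) j (dstep m)).

Lemma partial_cutoff m j x :
  partial j (cutoff m) x = slab m j x - slab m j (x - delta_mx 0 j).
Proof.
have [_] := is_derive_prod_fun (f := fun=> cutoff1 m) (x := x) (is_derive_cutoff1 m (x 0 j)).
rewrite /partial => ->; rewrite /slab !prod_fun_upd mulrBl; congr (_ - _).
rewrite !mxE !eqxx; congr (_ * _).
by apply: eq_bigr => k kj; rewrite !mxE eqxx (negbTE kj) subr0.
Qed.

(** A compact set outside which all cutoffs and slabs vanish, whatever [m] is. *)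
Definition unit_box : set 'rV[R]_n := [set x | forall k, `|x 0 k| <= 1].

Lemma unit_boxPn x : ~ unit_box x -> exists k, 1 < `|x 0 k|.
Proof. by move=> /existsNP[k /negP]; rewrite -ltNge => hk; exists k. Qed.

Lemma cutoff_eq0 m x : ~ unit_box x -> cutoff m x = 0.
Proof.
by move=> /unit_boxPn[k hk]; rewrite /cutoff (prod_funD1 _ k) cutoff1_eq0// mul0r.
Qed.

Lemma slab_eq0 m j x : ~ unit_box x -> slab m j x = 0.
Proof.
move=> /unit_boxPn[k hk]; rewrite /slab (prod_funD1 _ k) /upd.
by case: eqP => _; rewrite ?cutoff1_eq0 ?dstep_eq0// mul0r.
Qed.

Lemma ball0P (e : R) x : ball (0 : 'rV[R]_n) e x <-> 0 < e /\ forall k, `|x 0 k| < e.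
Proof.
split=> [[e0 h]|[e0 h]]; split=> //.
  by move=> k; have := h 0 k; rewrite /ball/= mxE sub0r normrN.
by move=> i k; rewrite (ord1 i) /ball/= mxE sub0r normrN.
Qed.

Lemma compact_unit_box : compact unit_box.
Proof.
have := @rV_compact R n (fun=> [set` `[-1, 1%R]]) (fun=> @segment_compact _ _ _).
congr (compact _); apply/seteqP; split=> x h k; have := h k;
  by rewrite /= in_itv/= ler_norml.
Qed.

Lemma unit_box_sub_ball (e : R) : 1 < e -> unit_box `<=` ball (0 : 'rV[R]_n) e.
Proof.
move=> e1 x hx; apply/ball0P; split; first exact: lt_trans e1.
by move=> k; exact: le_lt_trans e1.
Qed.

Lemma test_function_cutoff m (e : R) : 1 < e ->
  test_function (ball (0 : 'rV[R]_n) e) (cutoff m).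
Proof.
move=> e1; have sub : closure [set x | cutoff m x != 0] `<=` unit_box.
  rewrite [X in _ `<=` X](closure_id _).1; last first.
    apply: compact_closed; last exact: compact_unit_box.
    exact: norm_hausdorff.
  apply: closure_subset => x /= h; apply: contrapT => /(cutoff_eq0 m) h0.
  by rewrite h0 eqxx in h.
split; first by move=> k; apply: Ck_prod_fun => i; exact: smooth_cutoff1.
- apply: (subclosed_compact _ compact_unit_box) => //; exact: closed_closure.
- by apply: (subset_trans sub); exact: unit_box_sub_ball.
Qed.

Lemma cutoff_ge0 m x : 0 <= cutoff m x.
Proof. by apply: prodr_ge0 => k _; exact: cutoff1_ge0. Qed.

Lemma cutoff_le1 m x : cutoff m x <= 1.
Proof. by apply: prodr_ile1 => k _; rewrite cutoff1_ge0 cutoff1_le1. Qed.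

Lemma cvg_cutoff x : cutoff m x @[m --> \oo] --> (\1_(@half_open_cell R n) x : R).
Proof.
apply: cvg_near_cst; rewrite half_open_cellE -prod_indic.
have : \forall m \near \oo, forall k, cutoff1 m (x 0 k) = \1_[set` `[0, 1[] (x 0 k).
  apply: filter_forall => k; exact: cutoff1_near.
by apply: filterS => m h; apply: eq_bigr => k _; rewrite h.
Qed.

Lemma measurable_cutoff m : measurable_fun [set: borel R n] (cutoff m : borel R n -> R).
Proof.
apply: measurable_prod_coord => k; apply: measurable_smooth; exact: smooth_cutoff1.
Qed.

Lemma measurable_slab m j : measurable_fun [set: borel R n] (slab m j : borel R n -> R).
Proof.
apply: measurable_prod_coord => k; rewrite /upd; case: ifP => _; apply: measurable_smooth.
  exact: smooth_dstep.
exact: smooth_cutoff1.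
Qed.

(** The bound depends on [m]; it serves to make the product of a slab with an integrable [u]
    integrable at fixed [m]. *)
Lemma slab_bounded m j : exists C, forall x, `|slab m j x| <= C.
Proof.
have cs : {within unit_box, continuous (slab m j)}.
  apply: continuous_subspaceT; apply: continuous_prod_fun => k.
  apply: smooth_upto_continuous; rewrite /upd; case: ifP => _; first exact: smooth_dstep.
  exact: smooth_cutoff1.
have := compact_bounded (continuous_compact cs compact_unit_box).
move=> [M [_ hM]]; exists (`|M| + 1) => x.
have [hx|hx] := pselect (unit_box x); last by rewrite slab_eq0// normr0 addr_ge0.
apply: (hM (`|M| + 1)); first by rewrite ltr_pwDr// ler_norm.
by exists x.
Qed.

Lemma integral_slab m j :
  (\int[leb n]_x (slab m j x)%:E = (cutoff1_mass m ^+ n.-1)%:E :> \bar R)%E.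
Proof.
rewrite (@leb_integral_prod R n (upd (fun=> cutoff1 m) j (dstep m))
  (fun k => if k == j then 1 else cutoff1_mass m)).
- rewrite (bigD1 j)//= eqxx mul1r (eq_bigr (fun=> cutoff1_mass m)); last first.
    by move=> k /negbTE ->.
  rewrite prodr_const; congr (_ ^+ _)%:E.
  by rewrite -[in RHS](card_ord n) -(cardC1 j); apply: eq_card => k; rewrite inE.
- move=> k; rewrite /upd; case: ifP => _; apply: measurable_smooth.
    exact: smooth_dstep.
  exact: smooth_cutoff1.
- by move=> k t; rewrite /upd; case: ifP => _; rewrite ?dstep_ge0 ?cutoff1_ge0.
- by move=> k; rewrite /upd; case: ifP => _; rewrite ?integral_dstep ?integral_cutoff1.
Qed.

End product_cutoff.

(** * The mean value of the symmetrized gradient *)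

Section mean_value.
Context {R : realType} (n : nat).
(** Balls are sup-norm balls: radius 3 leaves room for [[-1,1]^n], which carries the cutoffs, and
    for its translates by unit vectors, contained in [[-1,2]^n]. *)
Local Notation Om := (ball (0 : 'rV[R]_n) 3 : set (borel R n)).

Lemma measurable_ball3 : measurable Om.
Proof. by apply: sub_sigma_algebra; exact: ball_open. Qed.

Lemma half_open_cell_sub_ball : @half_open_cell R n `<=` Om.
Proof.
move=> x h; apply: (@unit_box_sub_ball _ _ 3); first by rewrite ltr1n.
move=> k; have /andP[x0 x1] := h k.
by rewrite ger0_norm// ltW.
Qed.

Lemma unit_box_shift_sub_ball (j : 'I_n) (x : 'rV[R]_n) :
  unit_box x -> Om (x + delta_mx 0 j).
Proof.
move=> h; apply/ball0P; split; first by rewrite ltr0n.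
move=> k; rewrite !mxE eqxx/=; apply: (le_lt_trans (ler_normD _ _)).
rewrite normr_nat; have := h k; have : (k == j)%:R <= 1 :> R by case: (k == j).
by move=> a b; apply: (le_lt_trans (lerD b a)); lra.
Qed.

Lemma intvec_delta (j : 'I_n) :
  intvec (delta_mx 0 j) = delta_mx 0 j :> 'rV[R]_n.
Proof. by apply/rowP => k; rewrite !mxE; case: (_ && _). Qed.

Lemma affine_delta (xi : 'M[R]_n) (x : 'rV[R]_n) i j :
  affine xi (x + delta_mx 0 j) 0 i = affine xi x 0 i + xi i j.
Proof.
by rewrite /affine mulmxDl mxE; congr (_ + _); rewrite -rowE !mxE.
Qed.

(* Translating by the unit vector [e_j] turns [u_i] into [u_i + xi_ij] and maps
   the second slab of the partial derivative of the cutoff onto the first. *)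
Lemma integral_mul_partial_cutoff (u : 'rV[R]_n -> 'rV[R]_n) (xi : 'M[R]_n)
    (i j : 'I_n) (m : nat) : L1 Om u ->
  {ae leb n, forall x : 'rV[R]_n,
    u (x + intvec (delta_mx 0 j)) - affine xi (x + intvec (delta_mx 0 j)) =
    u x - affine xi x} ->
  (leb n).-integrable Om (fun x => (u x 0 i * partial j (cutoff m) x)%:E) /\
  (\int[leb n]_(x in Om) (u x 0 i * partial j (cutoff m) x))%R =
    - (xi i j * cutoff1_mass m ^+ n.-1).
Proof.
move=> /(_ i) iU per.
have mOm := measurable_ball3.
pose d : 'rV[R]_n := delta_mx 0 j.
pose g1 : borel R n -> R := slab m j.
pose g2 : borel R n -> R := fun x => slab m j ((x : 'rV[R]_n) - d).
have mg1 : measurable_fun [set: borel R n] g1 by exact: measurable_slab.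
have mg2 : measurable_fun [set: borel R n] g2.
  exact: (measurableT_comp mg1 (measurable_shift (- d))).
have [C hC] := @slab_bounded R n m j.
have bg1 : [bounded g1 x | x in Om].
  exists C; split; first by rewrite num_real.
  by move=> M CM x _ /=; exact: le_trans (hC x) (ltW CM).
have bg2 : [bounded g2 x | x in Om].
  exists C; split; first by rewrite num_real.
  by move=> M CM x _ /=; exact: le_trans (hC _) (ltW CM).
have iUg1 : (leb n).-integrable Om (EFin \o (fun x => u x 0 i * g1 x)).
  have := integrableMl mOm iU (measurable_funTS mg1) bg1.
  by apply: eq_integrable => // x _ /=; rewrite EFinM.
have iUg2 : (leb n).-integrable Om (EFin \o (fun x => u x 0 i * g2 x)).
  have := integrableMl mOm iU (measurable_funTS mg2) bg2.
  by apply: eq_integrable => // x _ /=; rewrite EFinM.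
have ig1 : (leb n).-integrable Om (EFin \o g1).
  apply: (@integrableS _ _ _ (leb n) setT) => //.
  apply/integrableP; split; first exact/measurable_EFinP.
  under eq_integral.
    move=> x _; rewrite /= ger0_norm; first over.
    rewrite /g1 /slab /prod_fun prodr_ge0// => k _; rewrite /upd.
    by case: ifP => _; rewrite ?dstep_ge0 ?cutoff1_ge0.
  by rewrite integral_slab ltry.
have int_g1 : (\int[leb n]_(x in Om) g1 x)%R = cutoff1_mass m ^+ n.-1.
  transitivity (fine (\int[leb n]_x (g1 x)%:E)%E); last by rewrite integral_slab.
  congr fine; rewrite [LHS]integral_mkcond; apply: eq_integral => x _.
  rewrite /patch; case: ifPn => // /negP; rewrite inE => xOm.
  rewrite /= /g1 slab_eq0// => xb; apply: xOm.
  by apply: unit_box_sub_ball xb; rewrite ltr1n.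
(* The ball is not translation invariant, so the integrand is extended by 0 to the whole space.
   Nothing is lost: after the shift the slab vanishes outside the unit box, and the box and its
   translate both lie in the ball. *)
pose G : borel R n -> \bar R := (EFin \o (fun x => u x 0 i * g2 x)) \_ Om.
have mG : measurable_fun [set: borel R n] G.
  by apply/(measurable_restrictT _ mOm); exact: measurable_int iUg2.
have GE : (fun x : borel R n => G ((x : 'rV[R]_n) + d)) =
    (EFin \o (fun x => u (x + d) 0 i * g1 x)) \_ Om.
  apply/funext => x; rewrite /G /patch /= /g2 addrK /g1.
  have [xb|xb] := pselect (unit_box (x : 'rV[R]_n)); last first.
    by rewrite slab_eq0// !mulr0 !if_same.
  rewrite !mem_set//; last exact: unit_box_shift_sub_ball.
  by apply: unit_box_sub_ball xb; rewrite ltr1n.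
have shiftE : (\int[leb n]_(x in Om) (u x 0 i * g2 x))%R =
    (\int[leb n]_(x in Om) (u x 0 i * g1 x + xi i j * g1 x))%R.
  rewrite /Rintegral; congr fine.
  rewrite integral_mkcond -(leb_integral_shift d mG) GE -integral_mkcond.
  apply: ae_eq_integral => //.
  - apply/(measurable_restrictT _ mOm); rewrite -GE.
    exact: (measurableT_comp mG (measurable_shift d)).
  - apply/measurable_EFinP; apply: measurable_funD.
      by apply/measurable_EFinP; exact: measurable_int iUg1.
    by apply: measurable_funM => //; exact: measurable_funTS.
  apply: (@filterS _ _ (ae_filter_ringOfSetsType (leb n)) _ _ _ per) => x /= + _; rewrite intvec_delta => /rowP/(_ i).
  have subE (a b : 'rV[R]_n) : (a - b) 0 i = a 0 i - b 0 i by rewrite !mxE.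
  rewrite !subE affine_delta => ux; congr EFin.
  rewrite -mulrDl; congr (_ * _).
  by move: ux; rewrite /d; lra.
have pE x : u x 0 i * partial j (cutoff m) x = u x 0 i * g1 x - u x 0 i * g2 x.
  by rewrite partial_cutoff mulrBr.
split.
  have := integrableB mOm iUg1 iUg2.
  by apply: eq_integrable => // x _ /=; rewrite pE EFinB.
under eq_Rintegral do rewrite pE.
rewrite RintegralB// shiftE RintegralD//; last first.
  have := integrableZl mOm (xi i j) ig1.
  by apply: eq_integrable => // x _ /=; rewrite EFinM.
by rewrite RintegralZl// int_g1; ring.
Qed.

(** The symmetrized gradient averages the contributions [xi i j] and [xi j i], which coincide
    because [xi] is symmetric. *)
Lemma charge_integral_cutoff (u : 'rV[R]_n -> 'rV[R]_n) (xi : 'M[R]_n)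
    (mu : 'I_n -> 'I_n -> {charge set (borel R n) -> \bar R}) (m : nat) i j :
  Msym xi -> L1 Om u ->
  (forall k : 'rV[int]_n, {ae leb n, forall x : 'rV[R]_n,
    u (x + intvec k) - affine xi (x + intvec k) = u x - affine xi x}) ->
  is_sym_gradient Om u mu ->
  charge_integral (mu i j) Om (cutoff m) = xi i j * cutoff1_mass m ^+ n.-1.
Proof.
move=> xis uL1 per /(_ (cutoff m)) grad.
have lt13 : 1 < 3 :> R by rewrite ltr1n.
have {grad} := grad (test_function_cutoff n m lt13) i j.
have [ii Ii] := integral_mul_partial_cutoff i m uL1 (per (delta_mx 0 j)).
have [ij Ij] := integral_mul_partial_cutoff j m uL1 (per (delta_mx 0 i)).
have Dij := @RintegralD _ _ _ (leb n) Om _ _ measurable_ball3 ii ij.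
rewrite [X in 2^-1 * X](_ : _ = - (xi i j * cutoff1_mass m ^+ n.-1) +
    - (xi j i * cutoff1_mass m ^+ n.-1)); last first.
  exact: (etrans Dij (congr2 +%R Ii Ij)).
move=> /eqP; rewrite -eqr_oppLR => /eqP <-.
have -> : xi j i = xi i j by rewrite -{1}xis mxE.
by field.
Qed.

Lemma cvg_Rintegral_cutoff (nu : {finite_measure set (borel R n) -> \bar R}) :
  (\int[nu]_(x in Om) cutoff m x)%R @[m --> \oo] --> fine (nu (@half_open_cell R n)).
Proof.
have mcell := @measurable_half_open_cell R n.
suff /fine_cvgP[] : (\int[nu]_(x in Om) (cutoff m x)%:E)%E @[m --> \oo] -->
    (fine (nu (@half_open_cell R n)))%:E by [].
rewrite fineK; last exact: fin_num_measure.
have -> : nu (@half_open_cell R n) =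
    (\int[nu]_(x in Om) (\1_(@half_open_cell R n) x)%:E)%E.
  rewrite integral_indic//; last exact: measurable_ball3.
  by rewrite setIidl//; exact: half_open_cell_sub_ball.
apply: (@dominated_cvg _ _ _ nu Om measurable_ball3 (fun m x => (cutoff m x)%:E) _
  (cst 1%E)) => //.
- by move=> m; apply/measurable_EFinP; apply: measurable_funTS; exact: measurable_cutoff.
- by move=> x _; apply: cvg_EFin; [exact: nearW|exact: cvg_cutoff].
- exact: (finite_measure_integrable_cst nu 1 measurable_ball3).
- by move=> m x _; rewrite abse_EFin lee_fin ger0_norm ?cutoff_ge0// cutoff_le1.
Qed.

(** Both Jordan parts of a charge are finite measures, so the constant 1 dominates the cutoffs for
    each of them. *)
Lemma cvg_charge_integral_cutoff (nu : {charge set (borel R n) -> \bar R}) :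
  charge_integral nu Om (cutoff m) @[m --> \oo] --> fine (nu (@half_open_cell R n)).
Proof.
have mcell := @measurable_half_open_cell R n.
rewrite /charge_integral; case: (cid _) => /= P hP; case: (cid _) => /= N hN.
have -> : nu (@half_open_cell R n) = (jordan_pos hN (@half_open_cell R n) -
    jordan_neg hN (@half_open_cell R n))%E.
  rewrite [LHS](jordan_decomp hN mcell) /cadd/= /cscale/=.
  by rewrite mulN1e.
rewrite fineB; [|exact: fin_num_measure|exact: fin_num_measure].
by apply: cvgB; exact: cvg_Rintegral_cutoff.
Qed.

(** Two limits of one sequence: dominated convergence yields the charge of the cell, while the
    explicit values are [xi i j] times a power of [cutoff1_mass m], which tends to 1. *)
Lemma sym_gradient_half_open_cell (u : 'rV[R]_n -> 'rV[R]_n) (xi : 'M[R]_n)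
    (mu : 'I_n -> 'I_n -> {charge set (borel R n) -> \bar R}) i j :
  Msym xi -> L1 Om u ->
  (forall k : 'rV[int]_n, {ae leb n, forall x : 'rV[R]_n,
    u (x + intvec k) - affine xi (x + intvec k) = u x - affine xi x}) ->
  is_sym_gradient Om u mu ->
  mu i j (@half_open_cell R n) = (xi i j)%:E.
Proof.
move=> xis uL1 per grad.
have mcell := @measurable_half_open_cell R n.
rewrite -[LHS]fineK; last exact: fin_num_measure.
congr EFin; have := @cvg_charge_integral_cutoff (mu i j).
rewrite (_ : (fun m => _) = (fun m => xi i j * cutoff1_mass m ^+ n.-1)); last first.
  by apply/funext => m; exact: charge_integral_cutoff xis uL1 per grad.
move=> /cvg_lim <- //; apply: cvg_lim => //.
rewrite -[X in _ --> X]mulr1; apply: cvgM; first exact: cvg_cst.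
rewrite -[X in _ --> X](expr1n _ n.-1).
have cx : continuous (fun x : R => x ^+ n.-1) by exact: exprn_continuous.
apply: (@cvg_comp _ _ _ _ (fun x : R => x ^+ n.-1) _ _ _ cvg_cutoff1_mass).
exact: cx.
Qed.

End mean_value.

(** * Matrix inequalities *)

Section matrix_inner_product.
Context {R : realType}.

Lemma sqr_mxnorm m n (x : 'M[R]_(m, n)) : mxnorm x ^+ 2 = mxdot x x.
Proof. by rewrite sqr_sqrtr// mxdot_ge0. Qed.

Lemma mxnorm_ge0 m n (x : 'M[R]_(m, n)) : 0 <= mxnorm x.
Proof. exact: sqrtr_ge0. Qed.

Lemma mxdotZl m n (a : R) (x y : 'M[R]_(m, n)) : mxdot (a *: x) y = a * mxdot x y.
Proof.
rewrite /mxdot mulr_sumr; apply: eq_bigr => i _; rewrite mulr_sumr.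
by apply: eq_bigr => j _; rewrite mxE mulrA.
Qed.

Lemma mxdotC m n (x y : 'M[R]_(m, n)) : mxdot x y = mxdot y x.
Proof. by apply: eq_bigr => i _; apply: eq_bigr => j _; rewrite mulrC. Qed.

Lemma mxdotDr m n (x y z : 'M[R]_(m, n)) : mxdot x (y + z) = mxdot x y + mxdot x z.
Proof.
rewrite /mxdot -big_split; apply: eq_bigr => i _; rewrite -big_split.
by apply: eq_bigr => j _; rewrite mxE mulrDr.
Qed.

Lemma mxdot_eq0 m n (x : 'M[R]_(m, n)) : (mxdot x x == 0) = (x == 0).
Proof.
apply/eqP/eqP => [x0|->]; last first.
  by rewrite /mxdot big1// => i _; rewrite big1// => j _; rewrite !mxE mul0r.
apply/matrixP => i j; have := ler_normr_mxnorm x i j.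
by rewrite /mxnorm x0 sqrtr0 normr_le0 mxE => /eqP.
Qed.

Lemma mxdot_delta m n (i : 'I_m) (j : 'I_n) (x : 'M[R]_(m, n)) :
  mxdot x (delta_mx i j) = x i j.
Proof.
rewrite /mxdot (bigD1 i)//= (bigD1 j)//= !mxE !eqxx mulr1 !big1 ?addr0//.
  by move=> k ki; rewrite big1// => l _; rewrite mxE (negbTE ki) mulr0.
by move=> l lj; rewrite mxE eqxx (negbTE lj) mulr0.
Qed.

Lemma continuous_sumr (T : topologicalType) I (s : seq I) (F : I -> T -> R) :
  (forall i, continuous (F i)) -> continuous (fun x => \sum_(i <- s) F i x).
Proof.
move=> cF; elim: s => [|i s IH] x.
  rewrite (_ : (fun y => _) = cst 0); first exact: cst_continuous.
  by apply/funext => y; rewrite big_nil.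
rewrite (_ : (fun y => _) = F i \+ (fun y => \sum_(k <- s) F k y)).
  by apply: continuousD; [exact: cF|exact: IH].
by apply/funext => y; rewrite big_cons.
Qed.

(** Exhibits the quadratic form as a polynomial in the entries; its continuity on the unit sphere
    and its measurability along [e] are read off from this. *)
Lemma mxdot_linearE m n (A : {linear 'M[R]_(m, n) -> 'M[R]_(m, n)}) (M : 'M[R]_(m, n)) :
  mxdot (A M) M =
  \sum_k \sum_l (\sum_i \sum_j M i j * A (delta_mx i j) k l) * M k l.
Proof.
apply: eq_bigr => k _; apply: eq_bigr => l _; congr (_ * _).
rewrite {1}(matrix_sum_delta M) linear_sum summxE; apply: eq_bigr => i _.
rewrite linear_sum summxE; apply: eq_bigr => j _.
by rewrite linearZ mxE.
Qed.

Lemma continuous_mxdot (T : topologicalType) m n (F G : T -> 'M[R]_(m, n)) :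
  (forall i j, continuous (fun x => F x i j)) ->
  (forall i j, continuous (fun x => G x i j)) ->
  continuous (fun x => mxdot (F x) (G x)).
Proof.
move=> cF cG; apply: continuous_sumr => i; apply: continuous_sumr => j x.
by apply: continuousM; [exact: cF|exact: cG].
Qed.

(** By compactness the form has a positive minimum [c] on the unit sphere of symmetric matrices;
    homogeneity then gives [|M|^2 <= c^-1 (A M, M)], and [|M|^2] dominates each squared entry. *)
Lemma pos_def_coercive n (A : {linear 'M[R]_n -> 'M[R]_n}) : (0 < n)%N ->
  pos_def_sym_operator A ->
  exists2 C, 0 < C & forall M, Msym M -> forall i j, M i j ^+ 2 <= C * mxdot (A M) M.
Proof.
move=> n0 [_ _ Apos].
(* Matrices are flattened to rows, to which [rV_compact] and [EVT_min_rV] apply. *)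
pose V (v : 'rV[R]_(n * n)) : 'M[R]_n := vec_mx v.
have cV i j : continuous (fun v => V v i j).
  rewrite (_ : (fun v => _) = (fun v : 'rV[R]_(n * n) => v 0 (mxvec_index i j))).
    exact: coord_continuous.
  by apply/funext => v; rewrite /V mxE.
(* Symmetry is expressed as the vanishing of a continuous function, so that [S] is visibly
   closed. *)
pose D (v : 'rV[R]_(n * n)) : 'M[R]_n := V v - (V v)^T.
have cD i j : continuous (fun v => D v i j).
  rewrite (_ : (fun v => _) = (fun v => V v i j) \- (fun v => V v j i)).
    by move=> v; apply: continuousB; exact: cV.
  by apply/funext => v; rewrite /D /= !mxE.
pose S := [set v | mxdot (V v) (V v) = 1] `&` [set v | mxdot (D v) (D v) = 0].
have symS v : S v -> Msym (V v).
  by move=> [_ /eqP]; rewrite mxdot_eq0 subr_eq0 => /eqP /esym.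
have cS : compact S.
  apply: (@subclosed_compact _ _ [set v : 'rV[R]_(n * n) | forall k, [set` `[(-1)%R, 1%R]] (v 0 k)]).
  - apply: closedI.
      apply: (@preimage_closed _ _ (fun v => mxdot (V v) (V v)) [set x | x = 1]).
        by move=> v _; exact: continuous_mxdot.
      exact: closed_eq.
    apply: (@preimage_closed _ _ (fun v => mxdot (D v) (D v)) [set x | x = 0]).
      by move=> v _; exact: continuous_mxdot.
    exact: closed_eq.
  - exact: (@rV_compact R (n * n) (fun=> [set` `[-1, 1%R]]) (fun=> @segment_compact _ _ _)).
  - move=> v [v1 _] k /=; rewrite in_itv/= -ler_norml.
    case/mxvec_indexP: k => i j.
    rewrite (_ : v 0 _ = V v i j); last by rewrite /V mxE.
    by apply: (le_trans (ler_normr_mxnorm _ i j)); rewrite /mxnorm v1 sqrtr1.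
have S0 : S !=set0.
  pose i0 := Ordinal n0; exists (mxvec (delta_mx i0 i0)); split => /=.
    by rewrite /V mxvecK mxdot_delta mxE !eqxx.
  by apply/eqP; rewrite mxdot_eq0 /D /V mxvecK trmx_delta subrr.
have cq : {within S, continuous (fun v => mxdot (A (V v)) (V v))}.
  apply: continuous_subspaceT.
  rewrite (_ : (fun v => _) = fun v => \sum_k \sum_l
    (\sum_i \sum_j V v i j * A (delta_mx i j) k l) * V v k l); last first.
    by apply/funext => v; exact: mxdot_linearE.
  apply: continuous_sumr => k; apply: continuous_sumr => l x.
  apply: continuousM; last exact: cV.
  apply: continuous_sumr => i; apply: continuous_sumr => j y.
  by apply: continuousM; [exact: cV|exact: cst_continuous].
have [v0 /set_mem Sv0 vmin] := EVT_min_rV S0 cS cq.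
set c := mxdot _ _ in vmin.
have c0 : 0 < c.
  apply: Apos; first exact: symS.
  by rewrite -mxdot_eq0 Sv0.1 oner_eq0.
exists c^-1; first by rewrite invr_gt0.
move=> M Msy i j; have [->|M0] := eqVneq M 0.
  by rewrite mxE expr0n/= [mxdot _ _]big1 ?mulr0// => k _; rewrite big1// => l _; rewrite mxE mulr0.
have M2 : 0 < mxdot M M by rewrite lt_neqAle mxdot_ge0 eq_sym mxdot_eq0 M0.
pose t := mxnorm M; have t0 : 0 < t by rewrite sqrtr_gt0.
have ttM : t ^+ 2 = mxdot M M by exact: sqr_mxnorm.
apply: (@le_trans _ _ (t ^+ 2)).
  by rewrite -real_normK ?num_real// ler_sqr ?nnegrE ?mxnorm_ge0// ler_normr_mxnorm.
rewrite mulrC ler_pdivlMr//.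
have Sv : S (mxvec (t^-1 *: M)).
  split; rewrite /= /D /V mxvecK.
    by rewrite mxdotZl mxdotC mxdotZl -ttM; field; rewrite gt_eqF.
  by apply/eqP; rewrite mxdot_eq0 linearZ/= Msy subrr.
have := vmin _ (mem_set Sv).
rewrite /V mxvecK linearZ/= mxdotZl mxdotC mxdotZl [mxdot M _]mxdotC mulrA -expr2.
by rewrite exprVn mulrC ler_pdivlMr ?exprn_gt0// mulrC.
Qed.

Lemma Msym_odot n (a b : 'rV[R]_n) : Msym (odot a b).
Proof.
by rewrite /Msym/= /odot linearZ/= linearD/= !trmx_mul !trmxK addrC.
Qed.

(** For symmetric [T] in [K0] the point [eta + r T] stays in the orthogonal cone for small [r], so
    [0 >= (T, eta + r T) = (T, eta) + r |T|^2]. The choice [r = e / (2 |T|)] turns this into the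
    claim with [s = e / 2]. *)
Lemma orthogonal_cone_interior n (K0 : set 'M[R]_n) :
  (forall T, K0 T -> Msym T) ->
  Msym_interior (orthogonal_cone (convex_hull K0)) !=set0 ->
  exists eta s, 0 < s /\ forall T, K0 T -> mxdot T eta <= - (s * mxnorm T).
Proof.
move=> K0sym [eta [etasym etaint]].
have : within (@Msym R n) (nbhs eta) (orthogonal_cone (convex_hull K0)).
  by rewrite nbhs_subspace_in.
rewrite /within/= => /nbhs_ballP[e /= e0 he].
exists eta, (e / 2); split; first by rewrite divr_gt0.
move=> T KT; have hT : convex_hull K0 T by exact: sub_gen_smallest KT.
have [->|T0] := eqVneq T 0.
  have z (y : 'M[R]_n) : mxdot 0 y = 0.
    by rewrite /mxdot big1// => k _; rewrite big1// => l _; rewrite mxE mul0r.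
  by rewrite /mxnorm !z sqrtr0 mulr0 oppr0.
have t0 : 0 < mxnorm T.
  by rewrite sqrtr_gt0 lt_neqAle mxdot_ge0 eq_sym mxdot_eq0 T0.
pose r := e / 2 / mxnorm T.
have r0 : 0 < r by rewrite !divr_gt0.
(* The ball is entrywise: each entry of [r T] is at most [e / 2] because [|T i j| <= |T|]. *)
have bz : ball eta e (eta + r *: T).
  split=> // i j; rewrite /ball/= !mxE opprD addNKr normrN normrM gtr0_norm//.
  rewrite /r mulrAC -mulrA mulrC mulrAC ltr_pdivrMr//.
  have h := ler_normr_mxnorm T i j; have ? : 0 <= `|T i j| by [].
  nra.
have [_ /(_ T hT)] : orthogonal_cone (convex_hull K0) (eta + r *: T).
  apply: he => //; rewrite /Msym/= linearD/= linearZ/=.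
  by rewrite (K0sym _ KT) (etasym : eta^T = eta).
rewrite mxdotDr [mxdot T (r *: T)]mxdotC mxdotZl -sqr_mxnorm.
rewrite /r expr2 mulrA divfK ?gt_eqF//.
lra.
Qed.

(** Follows from [2 |a (.) b|^2 = |a|^2 |b|^2 + (a,b)^2] and [tr (a (.) b) = (a,b)]. Keeping the
    trace makes the formula exact: dropping it bounds the jump height, and the identity itself
    recovers the height from the tensor. *)
Lemma sqr_mxnorm_odot n (a b : 'rV[R]_n) : mxnorm b = 1 ->
  mxnorm a ^+ 2 = 2 * mxdot (odot a b) (odot a b) - (\tr (odot a b)) ^+ 2.
Proof.
move=> b1; have bb : mxdot b b = 1 by rewrite -sqr_mxnorm b1 expr1n.
have dotE (x y : 'rV[R]_n) : mxdot x y = \sum_i x 0 i * y 0 i.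
  by rewrite /mxdot big_ord1.
have oE i j : odot a b i j = 2^-1 * (a 0 i * b 0 j + b 0 i * a 0 j).
  by rewrite /odot !mxE !big_ord1 !mxE.
have -> : \tr (odot a b) = mxdot a b.
  by rewrite dotE; apply: eq_bigr => i _; rewrite oE; field.
rewrite sqr_mxnorm.
have -> : mxdot (odot a b) (odot a b) =
    2^-1 * (mxdot a a * mxdot b b + mxdot a b ^+ 2).
  rewrite !dotE expr2.
  (* The product [|a|^2 |b|^2] is split into two halves with the factors exchanged, so that the
     expanded double sums match the square of [odot a b] term by term. *)
  transitivity (4^-1 * ((\sum_i a 0 i * a 0 i) * (\sum_i b 0 i * b 0 i)) +
    4^-1 * ((\sum_i b 0 i * b 0 i) * (\sum_i a 0 i * a 0 i)) +
    2^-1 * ((\sum_i a 0 i * b 0 i) * (\sum_i a 0 i * b 0 i))); last by field.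
  rewrite !big_distrlr /= !mulr_sumr -!big_split /=; apply: eq_bigr => i _.
  rewrite !mulr_sumr -!big_split /=; apply: eq_bigr => j _.
  by rewrite oE; field.
by rewrite bb; field.
Qed.

End matrix_inner_product.

(** * Energy estimates *)

Section energy_estimate.
Context {R : realType} (n : nat).
Local Notation H := (Hmeas (R := R) n n.-1).
Local Notation HT := (caratheodory_type (Houter (R := R) n n.-1)).
Local Notation Om := (ball (0 : 'rV[R]_n) 3).
Local Notation cell := (@half_open_cell R n).

(** Sublevel sets of [x_j] and their complements give [x_j <= a] and [a < x_j]. The half-open cell
    calls for the two other kinds of half-space, obtained from [- x_j]; the order is reversed, so
    [P] and [Q] change roles. *)
Lemma Hmeas_measurable_ge (j : 'I_n) (a : R) :
  measurable ([set x : 'rV[R]_n | a <= x ord0 j] : set HT).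
Proof.
rewrite (_ : mkset _ = [set x : 'rV[R]_n | - x ord0 j <= - a]); last first.
  by apply/seteqP; split=> x /=; rewrite lerN2.
apply: (caratheodory_sublevel (g := fun x : 'rV[R]_n => - x ord0 j)) => P Q r r0 h.
rewrite addeC setUC; apply: hausdorff_sep r0 _ => x y Qx Py.
by have := h _ _ Py Qx; lra.
Qed.

Lemma Hmeas_measurable_lt (j : 'I_n) (a : R) :
  measurable ([set x : 'rV[R]_n | x ord0 j < a] : set HT).
Proof.
rewrite (_ : mkset _ = ~` [set x : 'rV[R]_n | a <= x ord0 j]).
  by apply: measurableC; exact: Hmeas_measurable_ge.
by apply/seteqP; split=> x /=; rewrite real_ltNge ?num_real// => /negP.
Qed.

Lemma Hmeas_measurable_half_open_cell : measurable (cell : set HT).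
Proof.
rewrite (_ : cell = \bigcap_(j in [set: 'I_n])
    ([set x : 'rV[R]_n | 0 <= x ord0 j] `&` [set x : 'rV[R]_n | x ord0 j < 1])).
  apply: fin_bigcap_measurable; first exact: finite_finset.
  by move=> j _; apply: measurableI; [exact: Hmeas_measurable_ge|exact: Hmeas_measurable_lt].
apply/seteqP; split=> x h j; first by move=> _; have /andP[] := h j.
by have [/= -> ->] := h j I.
Qed.

Lemma Hmeas_measurable_ball3 : measurable (Om : set HT).
Proof.
rewrite (_ : Om = \bigcap_(j in [set: 'I_n])
    ([set x : 'rV[R]_n | x ord0 j < 3] `\` [set x : 'rV[R]_n | x ord0 j <= - 3])).
  apply: fin_bigcap_measurable; first exact: finite_finset.
  by move=> j _; apply: measurableD; [exact: Hmeas_measurable_lt|exact: Hmeas_measurable_le].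
apply/seteqP; split=> x.
  move=> /ball0P[_ h] j _; have := h j; rewrite ltr_norml => /andP[h1 h2].
  by split=> //=; apply/negP; rewrite -ltNge.
move=> h; apply/ball0P; split; first by rewrite ltr0n.
move=> j; have [/= h1 /negP] := h j I; rewrite -ltNge => h2.
by rewrite ltr_norml h1 h2.
Qed.

Variables (A : {linear 'M[R]_n -> 'M[R]_n}) (C : R).
Hypothesis C_gt0 : 0 < C.
Hypothesis coercive : forall M, Msym M -> forall i j,
  M i j ^+ 2 <= C * mxdot (A M) M.

Lemma sqr_opnorm M : (0 < n)%N -> Msym M -> opnorm A M ^+ 2 = mxdot (A M) M.
Proof.
move=> n0 Ms; rewrite sqr_sqrtr//.
have := coercive Ms (Ordinal n0) (Ordinal n0).
by move=> /(le_trans (sqr_ge0 _)); rewrite pmulr_rge0.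
Qed.

(* Young's inequality [|t| <= tau + t^2 / (4 tau)] replaces Cauchy-Schwarz. *)
Lemma integral_le_bulk_energy (e : 'rV[R]_n -> 'M[R]_n) (tau : R) i j :
  (0 < n)%N -> 0 < tau -> (forall x, Msym (e x)) ->
  (forall i j, (leb n).-integrable (Om : set (borel R n)) (fun x => (e x i j)%:E)) ->
  (`| \int[leb n]_(x in cell) (e x i j)%:E | <=
   tau%:E + (C / (2 * tau))%:E * bulk_energy A e)%E.
Proof.
move=> n0 tau0 esym ie.
have mcell := @measurable_half_open_cell R n.
have mopen := @measurable_open_cell R n.
have mOm := @measurable_ball3 R n.
have icell k l : (leb n).-integrable (cell : set (borel R n)) (fun x => (e x k l)%:E).
  exact: integrableS mOm mcell (@half_open_cell_sub_ball R n) (ie k l).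
have openE : cell `\` (cell `\` @open_cell R n) = @open_cell R n.
  apply/seteqP; split=> [x [cx /= h]|x ox].
    by apply: contrapT => nox; apply: h.
  by split; [exact: open_cell_sub|move=> [_]; exact].
rewrite (negligible_integral _ mcell (icell i j) (@leb_cellD R n)); last first.
  exact: measurableD.
rewrite openE.
have iopen k l : (leb n).-integrable (@open_cell R n : set (borel R n)) (fun x => (e x k l)%:E).
  exact: integrableS mcell mopen (@open_cell_sub R n) (icell k l).
have mq : measurable_fun (@open_cell R n : set (borel R n)) (fun x => opnorm A (e x) ^+ 2).
  rewrite (_ : (fun x => _) = (fun x => \sum_k \sum_l
    (\sum_p \sum_q e x p q * A (delta_mx p q) k l) * e x k l)); last first.
    by apply/funext => x; rewrite sqr_opnorm// mxdot_linearE.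
  have me k l : measurable_fun (@open_cell R n : set (borel R n)) (fun x => e x k l).
    by apply/measurable_EFinP; exact: measurable_int (iopen k l).
  apply: measurable_sum => k; apply: measurable_sum => l; apply: measurable_funM => //.
  apply: measurable_sum => p; apply: measurable_sum => q.
  by apply: measurable_funM => //; exact: me.
have q0 x : 0 <= opnorm A (e x) ^+ 2 by exact: sqr_ge0.
have meij : measurable_fun (@open_cell R n : set (borel R n)) (fun x => (e x i j)%:E).
  exact: measurable_int (iopen i j).
apply: (le_trans (le_abse_integral _ mopen meij)).
apply: (@le_trans _ _ (\int[leb n]_(x in @open_cell R n)
    (tau%:E + (C / (4 * tau))%:E * (opnorm A (e x) ^+ 2)%:E))%E).
  apply: ge0_le_integral => //.
  - by apply: measurableT_comp.
  - apply: emeasurable_funD => //; apply: emeasurable_funM => //.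
    exact/measurable_EFinP.
  - move=> x _; rewrite abse_EFin -EFinM -EFinD lee_fin.
    have h := coercive (esym x) i j.
    have t4 : 0 < 4 * tau by rewrite mulr_gt0.
    rewrite sqr_opnorm// mulrAC -lerBlDl ler_pdivlMr//; apply: le_trans h.
    rewrite -[leRHS]real_normK ?num_real// -subr_ge0.
    rewrite (_ : _ - _ = (`|e x i j| - 2 * tau) ^+ 2) ?sqr_ge0//; ring.
rewrite ge0_integralD//; last 3 first.
- by move=> x _; rewrite lee_fin ltW.
- by move=> x _; rewrite -EFinM lee_fin mulr_ge0// divr_ge0// ltW// mulr_gt0.
- by apply: emeasurable_funM => //; exact/measurable_EFinP.
apply: leeD.
  rewrite integral_cst// -[leRHS]mule1 le_eqVlt; apply/orP; left; apply/eqP.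
  by congr (_ * _)%E; exact: leb_open_cell.
rewrite ge0_integralZl//; last 3 first.
- exact/measurable_EFinP.
- by move=> x _; rewrite lee_fin.
- by rewrite lee_fin divr_ge0// ltW// mulr_gt0.
(* The factor 1/2 in the energy accounts for [C / (2 * tau)] in place of the [C / (4 * tau)] of
   Young's inequality. *)
rewrite /bulk_energy muleA -EFinM.
rewrite (_ : C / (2 * tau) * 2^-1 = C / (4 * tau))//.
by field; rewrite gt_eqF.
Qed.

Lemma mxdot_pair (X Y : 'M[R]_n) :
  mxdot X Y = \sum_(p : 'I_n * 'I_n) X p.1 p.2 * Y p.1 p.2.
Proof. by rewrite /mxdot pair_bigA. Qed.

Lemma jump_data_spec (u : 'rV[R]_n -> 'rV[R]_n) x : jump_set u x ->
  mxnorm (jump_data u x).2 = 1.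
Proof. by move=> [p hp]; have [] := xgetI (0, 0, 0) (hp : [set p | is_jump u x p] p). Qed.

Lemma sqr_jump_height (u : 'rV[R]_n -> 'rV[R]_n) x : jump_set u x ->
  mxnorm (jump_height u x) ^+ 2 =
  2 * mxdot (jump_tensor u x) (jump_tensor u x) - (\tr (jump_tensor u x)) ^+ 2.
Proof. by move=> /jump_data_spec; exact: sqr_mxnorm_odot. Qed.

Lemma jump_height_le (u : 'rV[R]_n -> 'rV[R]_n) x : jump_set u x ->
  mxnorm (jump_height u x) <= 2 * mxnorm (jump_tensor u x).
Proof.
move=> Jx; rewrite -ler_sqr ?nnegrE ?mulr_ge0 ?mxnorm_ge0//.
rewrite sqr_jump_height// exprMn sqr_mxnorm.
have := sqr_ge0 (\tr (jump_tensor u x)); have := mxdot_ge0 (jump_tensor u x).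
lra.
Qed.

(** The pairing with [eta] is estimated entry by entry, hence the sum of the [|eta p.1 p.2|] in the
    constant. The factor [2 / s] combines the bound of the height by twice the tensor with the
    strict negativity of [eta] on [K0]. *)
Lemma jump_energy_le (B : set 'rV[R]_n) (K0 : set 'M[R]_n) (xi eta : 'M[R]_n)
    (s tau b : R) u e : (0 < n)%N -> 0 < s -> 0 < tau -> Msym xi ->
  (forall T, K0 T -> mxdot T eta <= - (s * mxnorm T)) ->
  admissible B K0 xi u e -> bulk_energy A e = b%:E ->
  (jump_energy u <= (2 / s * (\sum_(p : 'I_n * 'I_n) `|eta p.1 p.2|) *
    (mxnorm xi + tau + C / (2 * tau) * b))%:E)%E.
Proof.
move=> n0 s0 tau0 xis etaK [uSBD _ JK per] bulkb.
have [[uL1 _] esym [mu [mus [grad dec jp]]]] : SBD Om u e.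
  apply: uSBD; first exact: ball_open.
  exists 3; split; first by rewrite num_real.
  move=> M M3 x; rewrite -ball_normE /ball_/= sub0r normrN => x3.
  exact: ltW (lt_trans x3 M3).
have mcell := @measurable_half_open_cell R n.
have mHcell := Hmeas_measurable_half_open_cell.
(* The indicator of the jump set stays inside the density, since [is_jump_part] supplies
   integrability for this product. *)
pose d i j x : R := \1_(jump_set u) x * jump_tensor u x i j.
have id i j : H.-integrable (cell : set HT) (fun x => (d i j x)%:E).
  apply: (@integrableS _ _ _ H (Om : set HT)) => //.
  - exact: Hmeas_measurable_ball3.
  - exact: half_open_cell_sub_ball.
  - by have [] := jp i j.
have md i j : measurable_fun (cell : set HT) (d i j : HT -> R).
  by apply/measurable_EFinP; exact: measurable_int (id i j).
have dE x i j : jump_set u x -> d i j x = jump_tensor u x i j.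
  by move=> Jx; rewrite /d indicE mem_set// mul1r.
have d0 x i j : ~ jump_set u x -> d i j x = 0.
  by move=> Jx; rewrite /d indicE memNset// mul0r.
pose a i j := (\int[leb n]_(x in cell) (e x i j)%:E)%E.
have ie i j : (leb n).-integrable (Om : set (borel R n)) (fun x => (e x i j)%:E).
  by have [] := dec i j.
have afin i j : a i j \is a fin_num.
  apply: integrable_fin_num => //; apply: integrableS (ie i j) => //.
    exact: measurable_ball3.
  exact: half_open_cell_sub_ball.
have aE i j : `|fine (a i j)| <= tau + C / (2 * tau) * b.
  rewrite -lee_fin -fine_abse// fineK ?abse_fin_num//.
  by rewrite EFinD EFinM -bulkb; exact: integral_le_bulk_energy.
(* The charge of the cell is [xi i j]; subtracting the absolutely continuous part leaves the jump
   part. *)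
have intd i j : (\int[H]_(x in cell) (d i j x)%:E = (xi i j - fine (a i j))%:E)%E.
  have musE : mus i j cell = (\int[H]_(x in cell) (d i j x)%:E)%E.
    by have [_] := jp i j; apply => //; exact: half_open_cell_sub_ball.
  have [_ decE _] := dec i j.
  have := decE _ mcell (@half_open_cell_sub_ball R n).
  rewrite (sym_gradient_half_open_cell i j xis uL1 per grad) musE -/(a i j).
  have := integrable_fin_num mHcell (id i j).
  rewrite -[in X in _ -> X -> _](fineK (afin i j)).
  case: (\int[_]_(_ in _) _)%E => [r| |]//= _ [->].
  by congr EFin; rewrite addrAC subrr add0r.
(* On the jump set [F] is minus the pairing of the tensor with [eta], hence non-negative almost
   everywhere by the choice of [eta]. *)
pose F x : R := - \sum_(p : 'I_n * 'I_n) eta p.1 p.2 * d p.1 p.2 x.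
have FE x : jump_set u x -> F x = - mxdot (jump_tensor u x) eta.
  move=> Jx; rewrite /F mxdot_pair; congr (- _); apply: eq_bigr => p _.
  by rewrite dE// mulrC.
have F0 x : ~ jump_set u x -> F x = 0.
  by move=> Jx; rewrite /F big1 ?oppr0// => p _; rewrite d0// mulr0.
have FEFin x : (F x)%:E =
    (\sum_(p : 'I_n * 'I_n) (- eta p.1 p.2)%:E * (d p.1 p.2 x)%:E)%E.
  rewrite /F -sumrN -sumEFin; apply: eq_bigr => p _.
  by rewrite -EFinM mulNr.
have iFp (p : 'I_n * 'I_n) : H.-integrable (cell : set HT)
    (fun x => ((- eta p.1 p.2)%:E * (d p.1 p.2 x)%:E)%E).
  exact: integrableZl.
have intF : (\int[H]_(x in cell) (F x)%:E <=
    ((\sum_(p : 'I_n * 'I_n) `|eta p.1 p.2|) *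
     (mxnorm xi + tau + C / (2 * tau) * b))%:E)%E.
  under eq_integral do rewrite FEFin.
  rewrite integral_sum// mulr_suml -sumEFin; apply: lee_sum => p _.
  rewrite integralZl// intd -EFinM lee_fin.
  apply: (le_trans (ler_norm _)); rewrite normrM normrN ler_wpM2l//.
  apply: (le_trans (ler_normB _ _)); rewrite -addrA lerD//.
  exact: ler_normr_mxnorm.
have mF : measurable_fun (cell : set HT) (F : HT -> R).
  rewrite (_ : F = fun x => \sum_(p : 'I_n * 'I_n) - eta p.1 p.2 * d p.1 p.2 x).
    by apply: measurable_sum => p; apply: measurable_funM; [exact: measurable_cst|exact: md].
  apply/funext => x; rewrite /F -sumrN; apply: eq_bigr => p _.
  by rewrite mulNr.
(* the height of the jump is a function of its tensor, hence measurable *)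
pose h x : R := Num.sqrt (2 * (\sum_i \sum_j d i j x * d i j x) - (\sum_i d i i x) ^+ 2).
have hE : (fun x => (mxnorm (jump_height u x))%:E) \_ (jump_set u) = EFin \o h.
  apply/funext => x; rewrite /patch /h /=; case: ifPn => [/set_mem Jx|/negP Jx].
    rewrite -[mxnorm _]ger0_norm ?mxnorm_ge0// -sqrtr_sqr sqr_jump_height//.
    congr (Num.sqrt (2 * _ - _ ^+ 2))%:E.
      by apply: eq_bigr => i _; apply: eq_bigr => j _; rewrite dE.
    by apply: eq_bigr => i _; rewrite dE.
  have nJ : ~ jump_set u x by move=> Jx'; apply: Jx; exact: mem_set.
  rewrite big1 => [|i _]; last by rewrite big1// => j _; rewrite d0// mul0r.
  rewrite big1 => [|i _]; last by rewrite d0.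
  by rewrite expr0n mulr0 subrr sqrtr0.
have mh : measurable_fun (cell : set HT) (h : HT -> R).
  apply: (measurableT_comp (continuous_measurable_fun (@sqrt_continuous R))).
  apply: measurable_funB.
    apply: measurable_funM; first exact: measurable_cst.
    apply: measurable_sum => i; apply: measurable_sum => j.
    by apply: measurable_funM; exact: md.
  by apply: measurable_funX; apply: measurable_sum => i; exact: md.
have hF : {ae H, forall x, (cell : set HT) x -> h x <= 2 / s * F x}.
  apply: (@filterS _ _ (ae_filter_ringOfSetsType H) _ _ _ JK) => x /= JKx _.
  have := congr1 (fun f => f x) hE; rewrite /patch /=; case: ifPn => [/set_mem Jx [<-]|/negP Jx [<-]].
    rewrite FE//; apply: (le_trans (jump_height_le Jx)).
    have etaT := etaK _ (JKx Jx); rewrite -mulrA ler_pM2l// ler_pdivlMl//.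
    by rewrite lerNr.
  by rewrite F0 ?mulr0// => Jx'; apply: Jx; exact: mem_set.
(* The restriction to the jump set moves into the integrand, where it produces the measurable
   function [h]. *)
rewrite /jump_energy setIC integral_mkcondr hE.
have mF2 : measurable_fun (cell : set HT) (fun x => (2 / s * F x)%:E).
  by apply/measurable_EFinP; apply: measurable_funM; [exact: measurable_cst|exact: mF].
have mF3 : measurable_fun (cell : set HT) (fun x => `|(2 / s * F x)%:E|%E).
  exact: measurableT_comp.
(* The sign of [F] is known only almost everywhere, whereas the comparison of integrals asks for it
   on all of the cell; the absolute value is inserted here and removed almost everywhere
   afterwards. *)
apply: (@le_trans _ _ (\int[H]_(x in cell) `|(2 / s * F x)%:E|)%E).
  apply: ae_ge0_le_integral => //.
  - by move=> x _; rewrite lee_fin sqrtr_ge0.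
  - exact/measurable_EFinP.
  apply: (@filterS _ _ (ae_filter_ringOfSetsType H) _ _ _ hF) => x /= + cx => /(_ cx) hx.
  by rewrite lee_fin; apply: le_trans (ler_norm _).
rewrite (@ae_eq_integral _ _ _ H (cell : set HT) (fun x => (2 / s * F x)%:E))//; last first.
  apply: (@filterS _ _ (ae_filter_ringOfSetsType H) _ _ _ hF) => x /= + cx => /(_ cx) hx.
  by rewrite ger0_norm//; apply: le_trans hx; exact: sqrtr_ge0.
under eq_integral do rewrite EFinM.
rewrite integralZl//; last first.
  rewrite (_ : (fun x => (F x)%:E) = (fun x =>
    \sum_(p : 'I_n * 'I_n) (- eta p.1 p.2)%:E * (d p.1 p.2 x)%:E)%E).
    by apply: integrable_sum => // p _; exact: iFp.
  by apply/funext => x; exact: FEFin.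
rewrite -(mulrA (2 / s)) [leRHS]EFinM; apply: lee_wpmul2l => //.
by rewrite lee_fin divr_ge0// ltW.
Qed.

End energy_estimate.

(** * Choice of the parameters and the linear bound *)

Theorem proposition5p3 (R : realType) (n : nat) (n_gt0 : (0 < n)%N)
  (A : {linear 'M[R]_n -> 'M[R]_n}) (A_pos : pos_def_sym_operator A)
  (B : set 'rV[R]_n)
  (B_closed : closed B) (B_rect : rectifiable B) (B_per : periodic_set B)
  (K0 : set 'M[R]_n) (K0_closed : closed K0) (K0_cone : is_cone K0)
  (K0_odot : forall xi, K0 xi -> exists a b : 'rV[R]_n, xi = odot a b)
  (K0_add : forall a b c : 'rV[R]_n,
    K0 (odot a b) -> K0 (odot a c) -> K0 (odot a (b + c)))
  (Kperp_int : Msym_interior (orthogonal_cone (convex_hull K0)) !=set0) :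
  exists c : R, 0 < c /\
    forall xi : 'M[R]_n, H_hom A B K0 xi ->
      (f_hom A B K0 xi <= (c * mxnorm xi)%:E)%E.
Proof.
have [C C0 coer] := pos_def_coercive n_gt0 A_pos.
have K0sym T : K0 T -> Msym T by move=> /K0_odot[a [b ->]]; exact: Msym_odot.
have [eta [s [s0 etaK]]] := orthogonal_cone_interior K0sym Kperp_int.
pose L := 2 / s * (\sum_(p : 'I_n * 'I_n) `|eta p.1 p.2|).
have L0 : 0 <= L by rewrite mulr_ge0 ?sumr_ge0// divr_ge0// ltW.
(* [L] vanishes when [eta] does; adding 1 keeps the constant, and the denominator of [tau] below,
   positive. *)
exists (L + 1); split; first by rewrite ltr_wpDl.
move=> xi [xis g0]; apply/lee_addgt0Pr => del del0.
(* Chosen so that [L * tau <= del / 2]. *)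
pose tau := del / (2 * (L + 1)).
have L1 : 0 < L + 1 by rewrite ltr_wpDl.
have tau0 : 0 < tau by rewrite divr_gt0// mulr_gt0.
(* The total coefficient of the bulk energy [b]: 1 from the energy itself, the rest from the jump
   estimate. A competitor with [b < del / (2 * k)], available since [g_hom] is 0, costs at most the
   other [del / 2]. *)
pose k := 1 + L * (C / (2 * tau)).
have k0 : 0 < k by rewrite ltr_pwDl// mulr_ge0// divr_ge0// ltW// mulr_gt0.
have : (g_hom A B K0 xi < (del / (2 * k))%:E)%E.
  by rewrite g0 lte_fin divr_gt0// mulr_gt0.
move=> /ereal_inf_lt[_ [u [e [adm ->]]] bulk_lt].
have bulk0 : (0 <= bulk_energy A e)%E.
  apply: mule_ge0; first by rewrite lee_fin invr_ge0.
  by apply: integral_ge0 => x _; rewrite lee_fin sqr_ge0.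
have bulk_fin : bulk_energy A e \is a fin_num.
  by rewrite ge0_fin_numE//; apply: lt_trans bulk_lt _; rewrite ltry.
pose b := fine (bulk_energy A e).
have bE : bulk_energy A e = b%:E by rewrite fineK.
have bk : b <= del / (2 * k) by rewrite -lee_fin -bE ltW.
have b0 : 0 <= b by rewrite -lee_fin -bE.
apply: (@le_trans _ _ (bulk_energy A e + jump_energy u)%E).
  by apply: ereal_inf_lbound; exists u, e.
have := jump_energy_le C0 coer n_gt0 s0 tau0 xis etaK adm bE.
rewrite -/L => /(leeD2l (bulk_energy A e)) /le_trans; apply.
rewrite bE -!EFinD lee_fin.
have Ltau : L * tau <= del / 2.
  rewrite /tau mulrA ler_pdivrMr ?mulr_gt0//.
  have -> : del / 2 * (2 * (L + 1)) = (L + 1) * del by field.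
  by rewrite ler_wpM2r ?lerDl// ltW.
have kb : k * b <= del / 2.
  apply: (le_trans (ler_wpM2l (ltW k0) bk)).
  by rewrite le_eqVlt; apply/orP; left; apply/eqP; field; rewrite gt_eqF.
have -> : b + L * (mxnorm xi + tau + C / (2 * tau) * b) =
    L * mxnorm xi + L * tau + k * b by rewrite /k; ring.
have := mxnorm_ge0 xi; move: Ltau kb; rewrite mulrDl mul1r.
move: (L * tau) (k * b) (L * mxnorm xi) (mxnorm xi) => x1 x2 x3 x4; lra.
Qed.
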